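(* Let $\varepsilon > 0$. Suppose there is an algorithm that, given two sequences of length $n$ over a linearly ordered alphabet, computes the length of their Longest Common Weakly Increasing Subsequence in $O(n^{2-\varepsilon})$ time. Then there is an algorithm that, given a CNF formula on $N$ variables and $M$ clauses, computes the maximum number of clauses that can be simultaneously satisfied by an assignment to the variables (MAX-CNF-SAT) in $O(2^{(1-\varepsilon/2)N}\,\mathrm{poly}(M))$ time.
   Context: Longest Common Weakly Increasing Subsequence (LCWIS): given two sequences $A$ and $B$ over an alphabet $\Sigma$ with a linear order $\le_\Sigma$, find a sequence $C$ that is weakly increasing with respect to $\le_\Sigma$, is a subsequence of both $A$ and $B$, and has maximum possible length; $\mathrm{LCWIS}(A,B)$ denotes this maximum length. *)

(* Defs.v *)
From HB Require Import structures.
From mathcomp Require Import all_boot all_order all_algebra.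
From mathcomp Require Import all_classical all_reals all_analysis.

Set Implicit Arguments.
Unset Strict Implicit.
Unset Printing Implicit Defensive.

Import Order.TTheory GRing.Theory Num.Theory.
Import numFieldNormedType.Exports.

Local Open Scope nat_scope.

(** * Word RAM

    The model of computation is the word RAM: finitely many registers (those
    named in the program) and a random access memory, both holding natural
    numbers of [w] bits.  Programs are structured; since a program has a fixed
    size, a program with jumps can be turned into a structured one with a
    constant factor slowdown, by keeping the program counter in a register. *)

Inductive binop :=
  | OpAdd | OpSub | OpMul | OpDiv | OpMod
  | OpAnd | OpOr | OpXor | OpShl | OpShr
  | OpEq | OpLt.

(* Subtraction is truncated at 0, and division by 0 is total: [m %/ 0 = 0],
   [m %% 0 = m]. *)
Definition eval_binop (o : binop) (m n : nat) : nat :=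
  match o with
  | OpAdd => m + n
  | OpSub => m - n
  | OpMul => m * n
  | OpDiv => m %/ n
  | OpMod => m %% n
  | OpAnd => Nat.land m n
  | OpOr  => Nat.lor m n
  | OpXor => Nat.lxor m n
  | OpShl => Nat.shiftl m n
  | OpShr => Nat.shiftr m n
  | OpEq  => m == n
  | OpLt  => m < n
  end.

Inductive cmd :=
  | Skip
  | Const of nat & nat              (* r_x := v *)
  | Op of binop & nat & nat & nat   (* r_x := r_y o r_z *)
  | ReadMem of nat & nat            (* r_x := mem[r_y] *)
  | WriteMem of nat & nat           (* mem[r_x] := r_y *)
  | Seq of cmd & cmd
  | If of nat & cmd & cmd           (* if r_x <> 0 then _ else _ *)
  | While of nat & cmd.             (* while r_x <> 0 do _ *)

Record state := State { regs : nat -> nat; mem : nat -> nat }.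

Definition upd (f : nat -> nat) (x v : nat) : nat -> nat :=
  fun y => if y == x then v else f y.

Definition set_reg (s : state) (x v : nat) : state :=
  State (upd (regs s) x v) (mem s).

Definition set_mem (s : state) (a v : nat) : state :=
  State (regs s) (upd (mem s) a v).

(* [exec w p s t s'] : on the RAM with [w]-bit words, [p] started in [s] halts
   in [s'] after exactly [t] steps, every elementary instruction and every test
   being one step.  Overflow is an error: there is no execution in which a
   register would receive a value that does not fit in a word. *)
Inductive exec (w : nat) : cmd -> state -> nat -> state -> Prop :=
  | ExecSkip s : exec w Skip s 0 s
  | ExecConst x v s :
      v < 2 ^ w ->
      exec w (Const x v) s 1 (set_reg s x v)
  | ExecOp o x y z s :
      eval_binop o (regs s y) (regs s z) < 2 ^ w ->
      exec w (Op o x y z) s 1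
        (set_reg s x (eval_binop o (regs s y) (regs s z)))
  | ExecReadMem x y s :
      mem s (regs s y) < 2 ^ w ->
      exec w (ReadMem x y) s 1 (set_reg s x (mem s (regs s y)))
  | ExecWriteMem x y s :
      exec w (WriteMem x y) s 1 (set_mem s (regs s x) (regs s y))
  | ExecSeq p q s s1 s2 t1 t2 :
      exec w p s t1 s1 -> exec w q s1 t2 s2 ->
      exec w (Seq p q) s (t1 + t2) s2
  | ExecIfTrue x p q s s1 t :
      regs s x <> 0 -> exec w p s t s1 ->
      exec w (If x p q) s t.+1 s1
  | ExecIfFalse x p q s s1 t :
      regs s x = 0 -> exec w q s t s1 ->
      exec w (If x p q) s t.+1 s1
  | ExecWhileTrue x p s s1 s2 t1 t2 :
      regs s x <> 0 -> exec w p s t1 s1 -> exec w (While x p) s1 t2 s2 ->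
      exec w (While x p) s (t1 + t2).+1 s2
  | ExecWhileFalse x p s :
      regs s x = 0 -> exec w (While x p) s 1 s.

(* The input occupies the first memory cells; everything else is initially 0. *)
Definition init_state (input : seq nat) : state :=
  State (fun _ => 0) (nth 0 input).

(* The output is read from register 0. *)
Definition outputs (w : nat) (p : cmd) (input : seq nat) (t out : nat) : Prop :=
  exists2 s, exec w p (init_state input) t s & regs s 0 = out.

(** * Longest common weakly increasing subsequences *)

Definition common_wis (d : Order.disp_t) (T : orderType d) (A B C : seq T) :
    Prop :=
  [/\ sorted <=%O C, subseq C A & subseq C B].

Definition is_LCWIS_length (d : Order.disp_t) (T : orderType d) (A B : seq T)
    (k : nat) : Prop :=
  (exists2 C, common_wis A B C & size C = k) /\
  (forall C, common_wis A B C -> size C <= k).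

Definition encode_LCWIS (A B : seq nat) : seq nat := size A :: A ++ B.

(* The symbols of the alphabet are natural numbers, compared by their usual
   order.  Words have O(log n + log s) bits, where s is the largest symbol. *)
Definition LCWIS_word (c n : nat) (A B : seq nat) : nat :=
  c * (trunc_log 2 (n + \max_(x <- A ++ B) x)).+1.

Definition LCWIS_algorithm (R : realType) (T : nat -> R) : Prop :=
  exists (p : cmd) (c : nat), forall (n : nat) (A B : seq nat),
    size A = n -> size B = n ->
    exists t k : nat,
      [/\ outputs (LCWIS_word c n A B) p (encode_LCWIS A B) t k,
          is_LCWIS_length A B k
        & (t%:R <= T n)%R].

(** * MAX-CNF-SAT *)

(* [(i, b)] is the literal satisfied by giving variable [i] the value [b]. *)
Definition literal (N : nat) : Type := ('I_N * bool)%type.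
Definition clause (N : nat) : Type := seq (literal N).
Definition cnf (N : nat) : Type := seq (clause N).

(* A clause is a set of literals, written as a list without repetition; in
   particular it has at most 2N literals.  Clauses themselves may be repeated. *)
Definition wf_cnf (N : nat) (F : cnf N) : bool :=
  all (fun c : seq ('I_N * bool) => uniq c) F.

Definition sat_clause (N : nat) (a : {ffun 'I_N -> bool}) (c : clause N) : bool :=
  has (fun l : literal N => a l.1 == l.2) c.

Definition max_sat (N : nat) (F : cnf N) : nat :=
  \max_(a : {ffun 'I_N -> bool}) count (sat_clause a) F.

Definition encode_literal (N : nat) (l : literal N) : nat := 2 * l.1 + l.2.

Definition encode_clause (N : nat) (c : clause N) : seq nat :=
  size c :: map (@encode_literal N) c.

Definition encode_cnf (N : nat) (F : cnf N) : seq nat :=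
  N :: size F :: flatten (map (@encode_clause N) F).

(* Words have O(N + log M) bits, as is needed to address a memory of size
   exponential in N and polynomial in M. *)
Definition max_sat_word (c N M : nat) : nat := c * (N + trunc_log 2 M).+1.

Definition MAX_CNF_SAT_algorithm (R : realType) (T : nat -> nat -> R) : Prop :=
  exists (p : cmd) (c : nat), forall (N M : nat) (F : cnf N),
    wf_cnf F -> size F = M ->
    exists t : nat,
      outputs (max_sat_word c N M) p (encode_cnf F) t (max_sat F) /\
      (t%:R <= T N M)%R.

(* Main.v *)
Require Import Defs.
From HB Require Import structures.
From mathcomp Require Import all_boot all_order all_algebra.
From mathcomp Require Import all_classical all_reals all_analysis.
From mathcomp Require Import zify ring lra.
From Stdlib Require PeanoNat.

Import Order.TTheory GRing.Theory Num.Theory.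
Import numFieldNormedType.Exports.
Import Defs.

Set Implicit Arguments.
Unset Strict Implicit.
Unset Printing Implicit Defensive.

(** If [eps > 1] the hypothesis is contradictory: an algorithm that runs in
    sublinear time leaves some cell of the input [1^n], [1^n] unread.

    For [eps <= 1] split the variables into two halves and represent each half
    assignment by the set of clauses it satisfies; [max_sat] is the maximum, over
    pairs of rows [i] and [j], of the number of clauses satisfied by row [i] of the
    first half or row [j] of the second.  Both LCWIS sequences are concatenations
    of [2 ^ k] blocks, one for each row, each block being weakly increasing.  The
    middle symbols of blocks [i] and [j] have a common subsequence of length twice
    the number of clauses satisfied by the pair [(i, j)].  The small symbols form
    [k] levels, the level of weight [2 ^ r] occurring only in blocks whose index is
    a multiple of [2 ^ r]: with [W] the multiplicity of a run of weight 1, the LCWIS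
    of the small symbols up to blocks [i] and [j] has length exactly [W * (i + j)],
    one unit for each binary digit of [i] and [j].  The large symbols are the mirror
    image, so that small and large symbols together contribute the constant
    [2 * W * (2 ^ k - 1)] when the middle symbols come from a single pair [(i, j)],
    and for [W] large compared with the length of the middle part it does not pay to
    use several pairs.  The separators cost a factor [k]; taking [k] at most the
    number of clauses, by merging half assignments that satisfy the same clauses,
    makes this polynomial in [M].

    The word RAM program packs the literals of a clause into two words, so that
    testing a half assignment against a clause takes constant time, and runs the
    LCWIS program with all of its memory addresses shifted past its own data. *)

Local Open Scope nat_scope.

(** * Executions of word RAM programs *)

Lemma exec_deterministic w p s t1 s1 :
  exec w p s t1 s1 -> forall t2 s2, exec w p s t2 s2 -> s1 = s2.
Proof.
elim=> {p s t1 s1}.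
- by move=> s t2 s2 E; inversion E.
- by move=> x v s _ t2 s2 E; inversion E.
- by move=> o x y z s _ t2 s2 E; inversion E.
- by move=> x y s _ t2 s2 E; inversion E.
- by move=> x y s t2 s2 E; inversion E.
- move=> p q s s1 s2 t1 t2 _ IH1 _ IH2 t3 s3 E; inversion E; subst.
  match goal with H : exec w p s _ ?s', H' : exec w q ?s' _ _ |- _ =>
    by rewrite -(IH1 _ _ H) in H'; apply: IH2 H' end.
- move=> x p q s s1 t nz _ IH t2 s2 E; inversion E; subst => //.
  match goal with H : exec w _ s _ _ |- _ => exact: IH H end.
- move=> x p q s s1 t nz _ IH t2 s2 E; inversion E; subst => //.
  match goal with H : exec w _ s _ _ |- _ => exact: IH H end.
- move=> x p s s1 s2 t1 t2 nz _ IH1 _ IH2 t3 s3 E; inversion E; subst => //.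
  match goal with H : exec w p s _ ?s', H' : exec w _ ?s' _ _ |- _ =>
    by rewrite -(IH1 _ _ H) in H'; apply: IH2 H' end.
- by move=> x p s z t2 s2 E; inversion E.
Qed.

(** [S] lists the cells that the run reads, at most one per step. A memory that agrees with [mem s]
    on [S] cannot be told apart, so it leads to the same registers in the same time. *)
Lemma exec_local w p s t s' : exec w p s t s' ->
  exists2 S : seq nat, size S <= t &
    forall m : nat -> nat, (forall a, a \in S -> m a = mem s a) ->
    exists2 m' : nat -> nat,
      exec w p (State (regs s) m) t (State (regs s') m') &
      forall a, m a = mem s a -> m' a = mem s' a.
Proof.
elim=> {p s t s'}.
- move=> s; exists [::] => // m _; exists m => //; exact: ExecSkip.
- move=> x v s lt_v; exists [::] => // m _; exists m => //.
  exact: (ExecConst x (State (regs s) m)).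
- move=> o x y z s lt_v; exists [::] => // m _; exists m => //.
  exact: (ExecOp (s := State (regs s) m) x).
- move=> x y s lt_v; exists [:: regs s y] => // m Hm; exists m => //.
  have <- : m (regs s y) = mem s (regs s y) by rewrite Hm ?mem_head.
  apply: (ExecReadMem (s := State (regs s) m) x) => /=.
  by rewrite Hm ?mem_head.
- move=> x y s; exists [::] => // m _.
  exists (upd m (regs s x) (regs s y)).
    exact: (ExecWriteMem w x y (State (regs s) m)).
  by move=> a; rewrite /= /upd; case: ifP.
- move=> p q s s1 s2 t1 t2 _ [S1 sz1 H1] _ [S2 sz2 H2].
  exists (S1 ++ S2); first by rewrite size_cat leq_add.
  move=> m Hm; case: (H1 m) => [a Sa|m1 E1 A1].
    by apply: Hm; rewrite mem_cat Sa.
  case: (H2 m1) => [a Sa|m2 E2 A2].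
    by apply: A1; apply: Hm; rewrite mem_cat Sa orbT.
  by exists m2; [apply: ExecSeq E1 E2 | move=> a /A1 /A2].
- move=> x p q s s1 t nz _ [S sz H]; exists S => [|m Hm]; first exact: leqW.
  case: (H m Hm) => m' E A; exists m' => //; exact: ExecIfTrue.
- move=> x p q s s1 t nz _ [S sz H]; exists S => [|m Hm]; first exact: leqW.
  case: (H m Hm) => m' E A; exists m' => //; exact: ExecIfFalse.
- move=> x p s s1 s2 t1 t2 nz _ [S1 sz1 H1] _ [S2 sz2 H2].
  exists (S1 ++ S2); first by rewrite size_cat leqW // leq_add.
  move=> m Hm; case: (H1 m) => [a Sa|m1 E1 A1].
    by apply: Hm; rewrite mem_cat Sa.
  case: (H2 m1) => [a Sa|m2 E2 A2].
    by apply: A1; apply: Hm; rewrite mem_cat Sa orbT.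
  by exists m2; [apply: ExecWhileTrue E1 E2 | move=> a /A1 /A2].
- move=> x p s z; exists [::] => // m _; exists m => //; exact: ExecWhileFalse.
Qed.

Fixpoint max_reg (p : cmd) : nat :=
  match p with
  | Skip => 0
  | Const x _ => x
  | Op _ x y z => maxn x (maxn y z)
  | ReadMem x y | WriteMem x y => maxn x y
  | Seq p q => maxn (max_reg p) (max_reg q)
  | If x p q => maxn x (maxn (max_reg p) (max_reg q))
  | While x p => maxn x (max_reg p)
  end.

(* [relocate rb rt p] is [p] with all memory addresses shifted by the content of
   register [rb]; register [rt] is scratch. *)
Fixpoint relocate (rb rt : nat) (p : cmd) : cmd :=
  match p with
  | ReadMem x y => Seq (Op OpAdd rt y rb) (ReadMem x rt)
  | WriteMem x y => Seq (Op OpAdd rt x rb) (WriteMem rt y)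
  | Seq p q => Seq (relocate rb rt p) (relocate rb rt q)
  | If x p q => If x (relocate rb rt p) (relocate rb rt q)
  | While x p => While x (relocate rb rt p)
  | p => p
  end.

Section Relocation.
Variables (w w' K base rb rt : nat).
Hypothesis room : 2 ^ w + base <= 2 ^ w'.
Hypotheses (Kb : K <= rb) (Kt : K <= rt) (bt : rb != rt).

(** The bound on the registers of [s] is kept so that an address plus [base] fits in the wider words
    of [s'], for which [room] provides. *)
Definition relocated (s s' : state) : Prop :=
  [/\ forall r, r < K -> regs s' r = regs s r,
      forall a, mem s' (base + a) = mem s a,
      regs s' rb = base & forall r, regs s r < 2 ^ w].

Lemma upd_same f x v : upd f x v x = v.
Proof. by rewrite /upd eqxx. Qed.

Lemma upd_other f x v y : y != x -> upd f x v y = f y.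
Proof. by rewrite /upd => /negbTE ->. Qed.

Lemma relocated_set_reg s s' x v : x < K -> v < 2 ^ w ->
  relocated s s' -> relocated (set_reg s x v) (set_reg s' x v).
Proof.
move=> ltx ltv [Hr Hm Hb Hw]; split=> //=.
- by move=> r lt_r; rewrite /upd; case: ifP => // _; apply: Hr.
- by rewrite upd_other //; lia.
- by move=> r; rewrite /upd; case: ifP.
Qed.

(** Every memory access becomes an address computation followed by the access, hence the factor 2.
    The last clause lets the caller keep data in the registers from [K] on, the scratch register
    excepted. *)
Lemma exec_relocate p s t s' : exec w p s t s' -> max_reg p < K ->
  forall u, relocated s u ->
  exists t' u', [/\ exec w' (relocate rb rt p) u t' u', t' <= 2 * t,
    relocated s' u' & forall r, K <= r -> r != rt -> regs u' r = regs u r].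
Proof.
have le_w v : v < 2 ^ w -> v < 2 ^ w' by lia.
elim=> {p s t s'} /=.
- move=> s _ u Ru; exists 0, u; split=> //; exact: ExecSkip.
- move=> x v s ltv ltx u Ru; exists 1, (set_reg u x v); split=> //.
  + exact/ExecConst/le_w.
  + exact: relocated_set_reg.
  + by move=> r Kr _ /=; rewrite upd_other //; lia.
- move=> o x y z s ltv lt_reg u Ru.
  have [Hr _ _ _] := Ru.
  have ey : regs u y = regs s y by apply: Hr; lia.
  have ez : regs u z = regs s z by apply: Hr; lia.
  exists 1, (set_reg u x (eval_binop o (regs s y) (regs s z))); split=> //.
  + rewrite -ey -ez; apply: ExecOp; rewrite ey ez; exact: le_w.
  + by apply: relocated_set_reg => //; lia.
  + by move=> r Kr _ /=; rewrite upd_other //; lia.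
- move=> x y s ltv lt_reg u Ru; have [Hr Hm Hb Hw] := Ru.
  have ey : regs u y = regs s y by apply: Hr; lia.
  pose u1 := set_reg u rt (regs u y + regs u rb).
  have Ru1 : relocated s u1.
    split=> //=; last by rewrite upd_other.
    by move=> r lt_r; rewrite upd_other; [apply: Hr | lia].
  have e1 : mem u1 (regs u1 rt) = mem s (regs s y).
    by rewrite /= upd_same ey Hb addnC Hm.
  exists (1 + 1), (set_reg u1 x (mem s (regs s y))); split=> //.
  + apply: (ExecSeq (s1 := u1)).
      by apply: ExecOp; rewrite /= ey Hb; have := Hw y; lia.
    by rewrite -e1; apply: ExecReadMem; rewrite e1; apply: le_w.
  + by apply: relocated_set_reg => //; lia.
  + by move=> r Kr nr /=; rewrite upd_other ?upd_other //; lia.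
- move=> x y s lt_reg u Ru; have [Hr Hm Hb Hw] := Ru.
  have ex : regs u x = regs s x by apply: Hr; lia.
  pose u1 := set_reg u rt (regs u x + regs u rb).
  have ey : regs u1 y = regs s y by rewrite /= upd_other ?Hr //; lia.
  exists (1 + 1), (set_mem u1 (regs u1 rt) (regs u1 y)); split=> //.
  + apply: (ExecSeq (s1 := u1)); last exact: ExecWriteMem.
    by apply: ExecOp; rewrite /= ex Hb; have := Hw x; lia.
  + rewrite ey; split=> //=.
    * by move=> r lt_r; rewrite upd_other; [apply: Hr | lia].
    * move=> a; rewrite upd_same /upd ex Hb addnC eqn_add2r -Hm addnC.
      by case: ifP.
    * by rewrite upd_other.
  + by move=> r Kr nr /=; rewrite upd_other.
- move=> p q s s1 s2 t1 t2 _ IH1 _ IH2 lt_reg u Ru.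
  have [|t1' [u1 [E1 T1 R1 F1]]] := IH1 _ u Ru; first by lia.
  have [|t2' [u2 [E2 T2 R2 F2]]] := IH2 _ u1 R1; first by lia.
  exists (t1' + t2'), u2; split=> //; first exact: ExecSeq E1 E2.
    by lia.
  by move=> r Kr nr; rewrite F2 ?F1.
- move=> x p q s s1 t nz _ IH lt_reg u Ru.
  have [Hr _ _ _] := Ru.
  have [|t' [u' [E T R' F]]] := IH _ u Ru; first by lia.
  exists t'.+1, u'; split=> //; last by lia.
  by apply: ExecIfTrue => //; rewrite Hr //; lia.
- move=> x p q s s1 t nz _ IH lt_reg u Ru.
  have [Hr _ _ _] := Ru.
  have [|t' [u' [E T R' F]]] := IH _ u Ru; first by lia.
  exists t'.+1, u'; split=> //; last by lia.
  by apply: ExecIfFalse => //; rewrite Hr //; lia.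
- move=> x p s s1 s2 t1 t2 nz _ IH1 _ IH2 lt_reg u Ru.
  have [Hr _ _ _] := Ru.
  have [|t1' [u1 [E1 T1 R1 F1]]] := IH1 _ u Ru; first by lia.
  have [|t2' [u2 [E2 T2 R2 F2]]] := IH2 _ u1 R1; first by lia.
  exists (t1' + t2').+1, u2; split=> //; last 2 first.
  + by lia.
  + by move=> r Kr nr; rewrite F2 ?F1.
  by apply: ExecWhileTrue E1 E2 => //; rewrite Hr //; lia.
- move=> x p s z lt_reg u Ru; have [Hr _ _ _] := Ru.
  exists 1, u; split=> //; apply: ExecWhileFalse; rewrite Hr //; lia.
Qed.

End Relocation.

(** * Sequences made of sorted blocks *)

Definition block (V : nat) (m : nat -> nat) : seq nat :=
  flatten [seq nseq (m v) v | v <- iota 0 V].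

Definition block_word (H V : nat) (mu : nat -> nat -> nat) : seq nat :=
  flatten [seq block V (mu i) | i <- iota 0 H].

Lemma flatten_iotaS (T : Type) (f : nat -> seq T) n :
  flatten [seq f i | i <- iota 0 n.+1] = flatten [seq f i | i <- iota 0 n] ++ f n.
Proof. by rewrite -addn1 iotaD map_cat flatten_cat /= cats0 add0n. Qed.

Lemma blockS V m : block V.+1 m = block V m ++ nseq (m V) V.
Proof. exact: flatten_iotaS. Qed.

Lemma block_wordS H V mu : block_word H.+1 V mu = block_word H V mu ++ block V (mu H).
Proof. exact: flatten_iotaS. Qed.

Lemma subseq_block_prefix V V' m : V <= V' -> subseq (block V m) (block V' m).
Proof.
move=> /subnK <-; elim: (V' - V) => // d IH.
by rewrite addSn blockS (subseq_trans IH) ?prefix_subseq.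
Qed.

Lemma subseq_block_word H H' V mu : H <= H' ->
  subseq (block_word H V mu) (block_word H' V mu).
Proof.
move=> /subnK <-; elim: (H' - H) => // d IH.
by rewrite addSn block_wordS (subseq_trans IH) ?prefix_subseq.
Qed.

Lemma subseq_nseq (T : eqType) (x : T) m n : m <= n -> subseq (nseq m x) (nseq n x).
Proof.
by move=> /subnK <-; rewrite addnC nseqD prefix_subseq.
Qed.

(** The run of [v] is taken from block [pos v]; as [pos] is monotone and each block is increasing,
    the runs appear in the right order. *)
Lemma block_subseq_word H V mu c pos :
  (forall u v, u <= v -> v < V -> pos u <= pos v) ->
  (forall v, v < V -> pos v < H) ->
  (forall v, v < V -> c v <= mu (pos v) v) ->
  subseq (block V c) (block_word H V mu).
Proof.
move=> pos_mono pos_lt c_le.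
(* Strengthened for induction on [v]: the runs below [v] fit in the blocks before [P] and the part
   below [v] of block [P], for every [P] that bounds their positions. *)
suff main v : v <= V -> forall P, (forall u, u < v -> pos u <= P) ->
    subseq (block v c) (block_word P V mu ++ block v (mu P)).
  have [->|V_gt0] := posnP V; first by rewrite sub0seq.
  have ltH := pos_lt V.-1 ltac:(lia).
  apply: (subseq_trans (main V _ (pos V.-1) _)) => //.
    by move=> u lt_u; apply: pos_mono; lia.
  by rewrite -block_wordS; apply: subseq_block_word.
elim: v => [|v IH] lt_v P le_P; first by rewrite sub0seq.
have le_vP : pos v <= P by apply: le_P.
apply: (@subseq_trans _ (block_word (pos v) V mu ++ block v.+1 (mu (pos v)))).
  rewrite !blockS catA; apply: cat_subseq; last exact/subseq_nseq/c_le.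
  by apply: IH => [|u lt_u]; [lia | apply: pos_mono; lia].
move: le_vP; rewrite leq_eqVlt => /orP[/eqP-> //|lt_vP].
apply: (@subseq_trans _ (block_word (pos v).+1 V mu)).
  by rewrite block_wordS cat_subseq // subseq_block_prefix.
by rewrite (subseq_trans (subseq_block_word V mu lt_vP)) ?prefix_subseq.
Qed.

Lemma size_block V m : size (block V m) = \sum_(0 <= v < V) m v.
Proof.
elim: V => [|V IH]; first by rewrite big_geq.
by rewrite blockS size_cat IH size_nseq big_nat_recr.
Qed.

Lemma size_block_word H V mu :
  size (block_word H V mu) = \sum_(0 <= i < H) \sum_(0 <= v < V) mu i v.
Proof.
elim: H => [|H IH]; first by rewrite big_geq.
by rewrite block_wordS size_cat IH size_block big_nat_recr.
Qed.

Lemma count_block V m v : count_mem v (block V m) = (v < V) * m v.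
Proof.
elim: V => [|V IH] //.
rewrite blockS count_cat IH count_nseq /= ltnS leq_eqVlt.
rewrite [V == v]eq_sym; case: (ltngtP v V) => [lt|gt|->] /=; lia.
Qed.

Lemma mem_block V m v : v \in block V m -> v < V.
Proof.
by move=> /flattenP[s /mapP[u]]; rewrite mem_iota => /andP[_ lt_u] -> /nseqP[->].
Qed.

Lemma mem_block_word H V mu v : v \in block_word H V mu -> v < V.
Proof. by move=> /flattenP[s /mapP[u _ ->]] /mem_block. Qed.

Lemma sorted_block V m : sorted leq (block V m).
Proof.
elim: V => [|V IH] //; rewrite blockS (sorted_pairwise leq_trans) pairwise_cat.
rewrite -!(sorted_pairwise leq_trans) IH /=; apply/andP; split.
  apply/allrelP => x y /mem_block lt_x /nseqP[-> _]; exact: ltnW.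
by elim: (m V) => // -[|n] //= ->; rewrite leqnn.
Qed.

Lemma subseq_catP (T : eqType) (C s t : seq T) : subseq C (s ++ t) ->
  exists C1 C2, [/\ C = C1 ++ C2, subseq C1 s & subseq C2 t].
Proof.
case/subseqP=> m sz_m ->.
exists (mask (take (size s) m) s), (mask (drop (size s) m) t).
rewrite !mask_subseq; split=> //.
rewrite -mask_cat ?cat_take_drop // size_takel // sz_m size_cat; exact: leq_addr.
Qed.

Lemma subseq_flatten (T : eqType) (ss : seq (seq T)) C : subseq C (flatten ss) ->
  exists2 Ds : seq (seq T), C = flatten Ds &
    size Ds = size ss /\ forall i, subseq (nth [::] Ds i) (nth [::] ss i).
Proof.
elim: ss C => [|s ss IH] C /=.
  by case: C => // _; exists [::] => //; split=> // i; rewrite nth_nil.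
case/subseq_catP=> C1 [C2 [-> sub1 /IH[Ds -> [sz sub2]]]].
by exists (C1 :: Ds) => //; split=> [|[|i]] //=; rewrite sz.
Qed.

Lemma count_sum_lt (C : seq nat) V : (forall x, x \in C -> x < V) ->
  size C = \sum_(0 <= v < V) count_mem v C.
Proof.
elim: C => [|x C IH] ltC /=; first by rewrite big1_eq.
rewrite big_split /= -IH => [|y Cy]; last by rewrite ltC ?inE ?Cy ?orbT.
rewrite big_mkord (bigD1 (Ordinal (ltC x (mem_head x C)))) //= eqxx big1 => [|i].
  by rewrite addn0 add1n.
by rewrite -val_eqE /= eq_sym => /negbTE ->.
Qed.

(* [e v] is the first block in which the subsequence uses a symbol [>= v]. *)
Lemma word_cut_points H V mu C : 0 < H -> sorted leq C ->
  subseq C (block_word H V mu) ->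
  exists2 e : nat -> nat,
    (forall u v, u <= v -> e u <= e v) /\ (forall v, e v < H) &
    forall v, count_mem v C <= \sum_(e v <= i < (e v.+1).+1) (v < V) * mu i v.
Proof.
move=> H_gt0 sortC /subseq_flatten[Ds def_C]; rewrite size_map size_iota.
case=> szD subD.
(* If no symbol [>= v] is used, [find] returns [H]; the minimum with [H.-1] keeps [e v] a valid
   block index. *)
pose e v := minn (find (has (leq v)) Ds) H.-1.
have e_mono u v : u <= v -> e u <= e v.
  move=> le_uv; rewrite /e leq_min geq_minr andbT.
  apply: leq_trans (geq_minl _ _) _.
  by apply: sub_find => D; apply: sub_has => x; apply: leq_trans.
have e_lt v : e v < H by rewrite /e; lia.
exists e => // v.
have cnt i : i < H -> count_mem v (nth [::] Ds i) <= (v < V) * mu i v.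
  move=> lt_i; rewrite -count_block.
  have := subD i; rewrite (nth_map 0) ?size_iota // nth_iota // add0n.
  exact: leq_count_subseq.
have sumC : count_mem v C = \sum_(0 <= i < H) count_mem v (nth [::] Ds i).
  by rewrite def_C count_flatten sumnE big_map (big_nth [::]) szD.
have low i : i < e v -> count_mem v (nth [::] Ds i) = 0.
  rewrite /e leq_min => /andP[lt_i _].
  have := before_find [::] lt_i; apply: contraFeq; rewrite -lt0n -has_count.
  by apply: sub_has => x /= /eqP ->.
(* Some block before [i] contributes a symbol above [v]; since [C] is sorted, [v] cannot occur
   afterwards. *)
have high i : e v.+1 < i -> i < H -> count_mem v (nth [::] Ds i) = 0.
  move=> lt_i lt_iH; set f := find (has (leq v.+1)) Ds.
  have lt_f : f < i by move: lt_i; rewrite /e -/f; lia.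
  have : has (leq v.+1) (nth [::] Ds f).
    by rewrite nth_find // has_find -/f szD; lia.
  case/hasP=> x fx lt_vx; apply/eqP; rewrite -leqn0 leqNgt -has_count.
  apply/hasP=> -[y iy /= /eqP def_y].
  have : pairwise leq C by rewrite -(sorted_pairwise leq_trans).
  rewrite def_C -(cat_take_drop i Ds) flatten_cat pairwise_cat.
  case/andP=> /allrelP /(_ x y) + _.
  suff -> : x \in flatten (take i Ds).
    suff -> : y \in flatten (drop i Ds) by rewrite def_y => /(_ isT isT); lia.
    by rewrite (drop_nth [::]) ?szD //= mem_cat iy.
  apply/flattenP; exists (nth [::] Ds f) => //.
  by rewrite -(nth_take _ lt_f) mem_nth // size_takel ?szD // ltnW.
have mono := e_mono _ _ (leqnSn v); have lte := e_lt v.+1.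
rewrite sumC (@big_cat_nat _ _ _ (e v)) //=; last by lia.
rewrite big_nat_cond big1 => [|i /andP[/andP[_ lt_i] _]]; last exact: low.
rewrite (@big_cat_nat _ _ _ (e v.+1).+1) //=; last by lia.
rewrite add0n [X in _ + X]big_nat_cond [X in _ + X]big1 => [|i]; last first.
  by case/andP=> /andP[lt_i lt_iH] _; apply: high.
rewrite addn0 big_nat_cond [leqRHS]big_nat_cond; apply: leq_sum => i.
by case/andP=> /andP[_ lt_i] _; apply: cnt; lia.
Qed.

(** * The LCWIS instance *)

(** Level [v %/ 2] has weight [2 ^ r], the heaviest level coming first. Its even symbol lies in the
    blocks whose index is an odd multiple of [2 ^ r], its odd symbol in all multiples, so that even
    symbols can spell out the binary digits of a block index. *)
Definition sep (W k i v : nat) : nat :=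
  let r := k.-1 - v %/ 2 in
  W * 2 ^ r * (if v %% 2 == 0 then i %% 2 ^ r.+1 == 2 ^ r else i %% 2 ^ r == 0).

(* Two coordinates [(x, 3 - x)] and [(z, 3 - z)] of blocks agree in
   [3 - `|x - z|] symbols; the values 1 and 3 of [x], 2 and 0 of [z] give 2,
   except that the pair (3, 0) gives 0. *)
Definition clause_runs (t : nat -> bool) (u : nat) : nat :=
  if u %% 2 == 0 then if t (u %/ 2) then 1 else 3
  else if t (u %/ 2) then 2 else 0.

(** The weight [6 * M] is tied to the [3 * M] middle symbols of a block: using [d > 0] further
    blocks gives at most [3 * M * (d + 1) <= 6 * M * d] middle symbols, no more than what is lost on
    separators. The last case reverses both symbols and blocks. *)
Definition mult (k M : nat) (t : nat -> nat -> bool) (i v : nat) : nat :=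
  if v < 2 * k then sep (6 * M) k i v
  else if v < 2 * k + 2 * M then clause_runs (t i) (v - 2 * k)
  else sep (6 * M) k (2 ^ k - 1 - i) (4 * k + 2 * M - 1 - v).

(** For [s = 1] this exchanges [2 * t] and [2 * t + 1], for [s = 0] it is the identity. The exchange
    makes a digit symbol of one sequence face the symbol of the other that occurs at all multiples.
    The program evaluates this same arithmetic form. *)
Definition flip (s v : nat) : nat := v + s - 2 * (s * (v %% 2)).

Definition lcwis_side (s k M : nat) (t : nat -> nat -> bool) : seq nat :=
  block_word (2 ^ k) (4 * k + 2 * M) (fun i v => mult k M t i (flip s v)).

Lemma flip0 v : flip 0 v = v. Proof. rewrite /flip; lia. Qed.

Lemma flip1_even t : flip 1 (2 * t) = (2 * t).+1.
Proof. rewrite /flip; lia. Qed.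

Lemma flip1_odd t : flip 1 (2 * t).+1 = 2 * t.
Proof. rewrite /flip; lia. Qed.

Lemma sum_pairs n (F : nat -> nat) :
  \sum_(0 <= v < 2 * n) F v = \sum_(0 <= t < n) (F (2 * t) + F (2 * t).+1).
Proof.
elim: n => [|n IH]; first by rewrite !big_geq.
have -> : 2 * n.+1 = (2 * n).+2 by lia.
by rewrite !big_nat_recr //= IH addnA.
Qed.

Lemma sum_nat_mono (F : nat -> nat) a b a' b' : a' <= a -> b <= b' ->
  \sum_(a <= i < b) F i <= \sum_(a' <= i < b') F i.
Proof.
move=> le_a le_b; have [le_ba|lt_ab] := leqP b a; first by rewrite big_geq.
rewrite (@big_cat_nat _ _ _ a a' b') //=; last by lia.
by rewrite (@big_cat_nat _ _ _ b a b') //=; lia.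
Qed.

Lemma leq_sum_nat (F G : nat -> nat) a b :
  (forall i, a <= i < b -> F i <= G i) ->
  \sum_(a <= i < b) F i <= \sum_(a <= i < b) G i.
Proof.
move=> le_FG; rewrite big_nat_cond [leqRHS]big_nat_cond.
by apply: leq_sum => i /andP[/le_FG].
Qed.

Lemma eq_sum_nat (F G : nat -> nat) a b :
  (forall i, a <= i < b -> F i = G i) ->
  \sum_(a <= i < b) F i = \sum_(a <= i < b) G i.
Proof. by move=> eq_FG; apply: eq_big_nat. Qed.

(** Reaching an odd multiple of [d] raises the index rounded down to a multiple of [d] by [d]. The
    term with [2 * d] stands for what the coarser levels have charged up to [a]. *)
Lemma sum_odd_multiples a b d : 0 < d -> a <= b ->
  \sum_(a <= i < b.+1) (i %% (2 * d) == d) * d + a %/ (2 * d) * (2 * d)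
    <= b %/ d * d.
Proof.
move=> d_gt0 /subnK <-; elim: (b - a) => [|n IH].
  rewrite add0n big_nat1.
  have -> : a %/ d = a %/ (2 * d) * 2 + a %% (2 * d) %/ d.
    by rewrite {1}(divn_eq a (2 * d)) mulnA divnMDl.
  rewrite mulnDl [_ %/ _ * (2 * d)]mulnA addnC leq_add2l.
  by case: eqP => [->|_] //; rewrite divnn d_gt0.
rewrite addSn big_nat_recr /=; last by lia.
set e := n + a in IH *.
have mono : e %/ d <= e.+1 %/ d by apply: leq_div2r.
case: eqP => [eq_d|_]; last first.
  by rewrite mul0n addn0; apply: leq_trans IH _; rewrite leq_mul2r mono orbT.
have dvd : d %| e.+1.
  by rewrite (divn_eq e.+1 (2 * d)) eq_d dvdn_add ?dvdn_mull.
have e1 : e.+1 %/ d * d = e.+1 by apply: divnK.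
suff : e %/ d * d + d <= e.+1 %/ d * d by lia.
rewrite -mulSnr leq_mul2r; apply/orP; right.
rewrite ltn_neqAle mono andbT; apply: contra_eqN e1 => /eqP <-.
by have := leq_trunc_div e d; lia.
Qed.

(* Each run of the first symbol of level [t] is charged to the [2 ^ r] blocks
   that end with its own, and these intervals are disjoint. *)
Lemma sep_sum_le W k (a b cnt : nat -> nat) :
  (forall t, t < k -> a t <= b t) ->
  (forall u t, u < t -> t < k -> b u <= a t) ->
  (forall t, t < k -> cnt t <= \sum_(a t <= i < (b t).+1) sep W k i (2 * t)) ->
  forall X, (forall t, t < k -> b t <= X) -> \sum_(0 <= t < k) cnt t <= W * X.
Proof.
move=> le_ab le_ba le_cnt.
(* For the first [n] levels the bound holds with [X] rounded down to a multiple of [2 ^ (k - n)],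
   which leaves room for the next, finer level; at [n = k] the rounding disappears. *)
suff main n : n <= k -> forall X, (forall t, t < n -> b t <= X) ->
    \sum_(0 <= t < n) cnt t <= W * (X %/ 2 ^ (k - n) * 2 ^ (k - n)).
  move=> X le_X; have := main k (leqnn k) X le_X.
  by rewrite subnn expn0 divn1 muln1.
elim: n => [|n IH] lt_n X le_X; first by rewrite big_geq.
rewrite big_nat_recr //=.
have {}IH := IH (ltnW lt_n) (a n) (fun t lt_t => le_ba t n lt_t lt_n).
set r := k - n.+1; have er : k - n = r.+1 by rewrite /r; lia.
have le_bX : b n <= X by apply: le_X.
have := le_cnt n lt_n.
have -> : \sum_(a n <= i < (b n).+1) sep W k i (2 * n) =
    W * \sum_(a n <= i < (b n).+1) (i %% (2 * 2 ^ r) == 2 ^ r) * 2 ^ r.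
  rewrite big_distrr /=; apply: eq_bigr => i _.
  rewrite /sep mulKn // modnMr /= -expnS (_ : k.-1 - n = r); last by lia.
  by rewrite -mulnA; congr (_ * _); apply: mulnC.
have := @sum_odd_multiples (a n) (b n) (2 ^ r) (expn_gt0 _ _) (le_ab n lt_n).
rewrite -expnS -er.
have : b n %/ 2 ^ r * 2 ^ r <= X %/ 2 ^ r * 2 ^ r.
  by rewrite leq_mul2r leq_div2r ?orbT.
move: (\sum_(a n <= i < _) _ : nat) => S h1 h2 h3.
apply: leq_trans (leq_add IH h3) _.
rewrite -mulnDr leq_mul2l; apply/orP; right; lia.
Qed.

Lemma clause_runs_sum t M : \sum_(0 <= u < 2 * M) clause_runs t u = 3 * M.
Proof.
rewrite sum_pairs mulnC -[M in RHS]subn0 -sum_nat_const_nat.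
apply: eq_sum_nat => c _; rewrite /clause_runs.
have -> : (2 * c) %% 2 = 0 by lia.
have -> : (2 * c).+1 %% 2 = 1 by lia.
have -> : (2 * c) %/ 2 = c by lia.
have -> : (2 * c).+1 %/ 2 = c by lia.
by case: (t c).
Qed.

Lemma clause_runs_min t t' c :
  minn (clause_runs t (2 * c)) (clause_runs t' (2 * c).+1)
    + minn (clause_runs t (2 * c).+1) (clause_runs t' (2 * c)) = 2 * (t c || t' c).
Proof.
rewrite /clause_runs.
have -> : (2 * c) %% 2 = 0 by lia.
have -> : (2 * c).+1 %% 2 = 1 by lia.
have -> : (2 * c) %/ 2 = c by lia.
have -> : (2 * c).+1 %/ 2 = c by lia.
by case: (t c) (t' c) => [] [].
Qed.

Lemma sum_nat_rev (F : nat -> nat) H a b : a <= b <= H ->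
  \sum_(a <= i < b) F (H - 1 - i) = \sum_(H - b <= i < H - a) F i.
Proof.
case/andP=> /subnK <-; elim: (b - a) => [|d IH] le_bH.
  by rewrite add0n !big_geq.
rewrite addSn big_nat_recr /=; last by lia.
rewrite IH; last by lia.
rewrite [RHS]big_ltn; last by lia.
by rewrite addnC; congr (F _ + \sum_(_ <= i < _) F i); lia.
Qed.

(** * Upper bound on the length of the LCWIS *)

Section Upper.
Variables (k M s : nat) (t : nat -> nat -> bool) (C : seq nat).
Hypotheses (s_le1 : s <= 1) (sortC : sorted leq C)
  (subC : subseq C (lcwis_side s k M t)).
Let cnt v := count_mem v C.
Let V := 4 * k + 2 * M.

(** Small separators come from blocks up to [x1], large ones from blocks from [x2] on, middle
    symbols from between. Only the separators that act as even symbols of [sep] after [flip s] are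
    bounded; the other sequence bounds the rest. *)
Lemma side_bounds : exists x1 x2, [/\ x1 <= x2 < 2 ^ k,
  \sum_(0 <= l < k) cnt (2 * l + s) <= 6 * M * x1,
  \sum_(0 <= l < k) cnt (V - 1 - (2 * l + s)) <= 6 * M * (2 ^ k - 1 - x2),
  \sum_(0 <= u < 2 * M) cnt (2 * k + u) <= 3 * M * (x2 + 1 - x1) &
  x1 = x2 -> forall u, u < 2 * M -> cnt (2 * k + u) <= clause_runs (t x1) (flip s u)].
Proof.
have H_gt0 : 0 < 2 ^ k by rewrite expn_gt0.
have [e [e_mono e_lt] le_cnt] := word_cut_points H_gt0 sortC subC.
have flip_s l : flip s (2 * l + s) = 2 * l.
  by move: s_le1; rewrite /flip; case: (s) => [|[|]] //; lia.
have flip_V l : 2 * l + s < V -> flip s (V - 1 - (2 * l + s)) = V - 1 - 2 * l.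
  by move: s_le1; rewrite /flip /V; case: (s) => [|[|]] //; lia.
have flip_k u : flip s (2 * k + u) = 2 * k + flip s u.
  by move: s_le1; rewrite /flip; case: (s) => [|[|]] //; lia.
have flip_lt u : u < 2 * M -> flip s u < 2 * M.
  by move: s_le1; rewrite /flip; case: (s) => [|[|]] //; lia.
have cnt_mid u : u < 2 * M -> cnt (2 * k + u) <=
    \sum_(e (2 * k + u) <= i < (e (2 * k + u).+1).+1) clause_runs (t i) (flip s u).
  move=> lt_u; apply: leq_trans (le_cnt _) _; apply: leq_sum_nat => i _.
  have /flip_lt lt_f := lt_u.
  rewrite /mult flip_k ifF; last by lia.
  rewrite ifT; last by lia.
  by rewrite addKn; case: (_ < _); rewrite ?mul1n.
(* The first blocks in which a symbol beyond the small separators, respectively a large separator,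
   is used. *)
exists (e (2 * k)), (e (2 * k + 2 * M)); split.
- by rewrite e_mono ?e_lt //; lia.
- apply: (@sep_sum_le _ k (fun l => e (2 * l + s)) (fun l => e (2 * l + s).+1)).
  + by move=> l _; apply: e_mono.
  + by move=> u l lt_u _; apply: e_mono; lia.
  + move=> l lt_l; apply: leq_trans (le_cnt _) _; apply: leq_sum_nat => i _.
    rewrite /mult flip_s ifT; last by lia.
    by case: (_ < _); rewrite ?mul1n.
  + by move=> l lt_l; apply: e_mono; lia.
- apply: (@sep_sum_le _ k (fun l => 2 ^ k - 1 - e (V - 1 - (2 * l + s)).+1)
                          (fun l => 2 ^ k - 1 - e (V - 1 - (2 * l + s)))).
  + by move=> l lt_l; rewrite leq_sub2l // e_mono.
  + by move=> u l lt_u lt_l; rewrite leq_sub2l // e_mono // /V; lia.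
  + move=> l lt_l; set v := V - 1 - (2 * l + s).
    have ltv := e_lt v; have ltv1 := e_lt v.+1.
    have lev : e v <= e v.+1 by rewrite e_mono.
    have -> : (2 ^ k - 1 - e v).+1 = 2 ^ k - e v by lia.
    have -> : 2 ^ k - 1 - e v.+1 = 2 ^ k - (e v.+1).+1 by lia.
    rewrite -sum_nat_rev; last by lia.
    apply: leq_trans (le_cnt _) _; apply: leq_sum_nat => i _.
    rewrite /mult /v flip_V; last by rewrite /V; lia.
    rewrite ifF; last by rewrite /V; lia.
    rewrite ifF; last by rewrite /V; lia.
    rewrite -/V (_ : V - 1 - (V - 1 - 2 * l) = 2 * l); last by rewrite /V; lia.
    by case: (_ < _); rewrite ?mul1n.
  + by move=> l lt_l; rewrite leq_sub2l // e_mono // /V; lia.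
- apply: (@leq_trans (\sum_(0 <= u < 2 * M)
      \sum_(e (2 * k) <= i < (e (2 * k + 2 * M)).+1) clause_runs (t i) (flip s u))).
    apply: leq_sum_nat => u lt_u.
    apply: leq_trans (cnt_mid _ _) _; first by lia.
    by apply: sum_nat_mono; [|rewrite ltnS]; apply: e_mono; lia.
  rewrite exchange_big_nat /=.
  rewrite (_ : 3 * M * _ = (\sum_(e (2 * k) <= i < (e (2 * k + 2 * M)).+1) 3 * M)).
    apply: leq_sum_nat => i _; rewrite -(clause_runs_sum (t i)) !sum_pairs.
    apply: leq_sum_nat => c _; move: s_le1.
    by case: (s) => [|[|]] //; rewrite ?flip0 // flip1_even flip1_odd addnC.
  by rewrite sum_nat_const_nat mulnC addn1.
- move=> eq_e u lt_u; apply: leq_trans (cnt_mid _ lt_u) _.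
  have le1 : e (2 * k) <= e (2 * k + u) by apply: e_mono; lia.
  have le2 : e (2 * k + u).+1 <= e (2 * k + 2 * M) by apply: e_mono; lia.
  have le3 : e (2 * k + u) <= e (2 * k + u).+1 by apply: e_mono; lia.
  have -> : e (2 * k + u).+1 = e (2 * k) by lia.
  have -> : e (2 * k + u) = e (2 * k) by lia.
  by rewrite big_nat1.
Qed.

End Upper.

(** Each separator is bounded by the side on which it plays the even role. If a side draws on
    several blocks for the middle, the missing separators pay for the excess; otherwise the middle
    comes from one pair of blocks and is bounded by the runwise minimum. *)
Lemma lcwis_upper k M tA tB C : sorted leq C ->
  subseq C (lcwis_side 0 k M tA) -> subseq C (lcwis_side 1 k M tB) ->
  exists i j, [/\ i < 2 ^ k, j < 2 ^ k & size C <=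
    12 * M * (2 ^ k - 1) + 2 * \sum_(0 <= c < M) (tA i c || tB j c)].
Proof.
move=> sortC subA subB.
have [x1 [x2 [ltx A1 A2 A3 A4]]] := side_bounds (leq0n _) sortC subA.
have [y1 [y2 [lty B1 B2 B3 B4]]] := side_bounds (leqnn _) sortC subB.
set V := 4 * k + 2 * M in A2 B2.
have size_C : size C =
    \sum_(0 <= l < k) count_mem (2 * l + 0) C
    + \sum_(0 <= l < k) count_mem (2 * l + 1) C
    + \sum_(0 <= u < 2 * M) count_mem (2 * k + u) C
    + \sum_(0 <= l < k) count_mem (V - 1 - (2 * l + 0)) C
    + \sum_(0 <= l < k) count_mem (V - 1 - (2 * l + 1)) C.
  rewrite (@count_sum_lt C V) => [|x Cx]; last first.
    by have /mem_block_word := mem_subseq subA Cx.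
  have -> : V = 2 * (2 * k + M) by rewrite /V; lia.
  rewrite sum_pairs (@big_cat_nat _ _ _ k) //=; last by lia.
  rewrite (@big_cat_nat _ _ _ (k + M) k) //=; [|lia|lia].
  pose G l := count_mem (2 * l) C + count_mem (2 * l).+1 C.
  have E1 : \sum_(0 <= l < k) G l = \sum_(0 <= l < k) count_mem (2 * l + 0) C
      + \sum_(0 <= l < k) count_mem (2 * l + 1) C.
    by rewrite -big_split; apply: eq_sum_nat => l _; rewrite addn0 addn1.
  have E2 : \sum_(k <= l < k + M) G l =
      \sum_(0 <= u < 2 * M) count_mem (2 * k + u) C.
    rewrite sum_pairs -[LHS]/(\sum_(0 + k <= l < k + M) G l) big_addn addKn /G.
    apply: eq_sum_nat => l _.
    have -> : 2 * (l + k) = 2 * k + 2 * l by lia.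
    by rewrite addnS.
  have E3 : \sum_(k + M <= l < 2 * k + M) G l =
      \sum_(0 <= l < k) count_mem (2 * (2 * k + M) - 1 - (2 * l + 0)) C
      + \sum_(0 <= l < k) count_mem (2 * (2 * k + M) - 1 - (2 * l + 1)) C.
    rewrite -big_split /=.
    have := @sum_nat_rev (fun l => count_mem (2 * (2 * k + M) - 1 - (2 * l + 0)) C
      + count_mem (2 * (2 * k + M) - 1 - (2 * l + 1)) C)
      (2 * k + M) (k + M) (2 * k + M).
    rewrite subnn (_ : 2 * k + M - (k + M) = k); last by lia.
    move=> <-; last by lia.
    apply: eq_big_nat => l lt_l; rewrite [RHS]addnC /G.
    have -> : 2 * (2 * k + M) - 1 - (2 * (2 * k + M - 1 - l) + 1) = 2 * l by lia.
    by have -> : 2 * (2 * k + M) - 1 - (2 * (2 * k + M - 1 - l) + 0) = (2 * l).+1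
      by lia.
  by rewrite E1 E2 E3 -!addnA.
(* The separators number at most [12 * M * (2 ^ k - 1)], less [6 * M] for each block skipped between
   [x1] and [x2] or between [y1] and [y2]. *)
have end_bound mid : \sum_(0 <= u < 2 * M) count_mem (2 * k + u) C <=
      6 * M * (x2 - x1) + 6 * M * (y2 - y1) + mid ->
    size C <= 12 * M * (2 ^ k - 1) + mid.
  have eqA : 6 * M * (2 ^ k - 1) =
      6 * M * x1 + 6 * M * (x2 - x1) + 6 * M * (2 ^ k - 1 - x2).
    by rewrite -!mulnDr; congr (_ * _); lia.
  have eqB : 6 * M * (2 ^ k - 1) =
      6 * M * y1 + 6 * M * (y2 - y1) + 6 * M * (2 ^ k - 1 - y2).
    by rewrite -!mulnDr; congr (_ * _); lia.
  rewrite size_C (_ : 12 * M * _ = 6 * M * (2 ^ k - 1) + 6 * M * (2 ^ k - 1)).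
    rewrite {1}eqA eqB; move: A1 A2 B1 B2; clear.
    do !move: (6 * M * _); lia.
  by rewrite -mulnDl; congr (_ * _); lia.
exists x1, y1; split; [by lia | by lia|].
have [eqx|nex] := eqVneq x1 x2; last first.
  apply: end_bound; apply: leq_trans A3 _.
  have -> : x2 + 1 - x1 = (x2 - x1) + 1 by lia.
  apply: leq_trans (leq_addr _ _); apply: leq_trans (leq_addr _ _).
  by have := leq_pmulr (3 * M) (_ : 0 < x2 - x1); rewrite mulnDr; lia.
(* The first side now uses a single block, so there are at most [3 * M] middle symbols, and one
   skipped block on the other side pays for them. *)
have [eqy|ney] := eqVneq y1 y2; last first.
  apply: end_bound; apply: leq_trans A3 _; rewrite eqx.
  have := leq_pmulr (6 * M) (_ : 0 < y2 - y1); lia.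
apply: end_bound; apply: leq_trans (leq_addl _ _).
rewrite sum_pairs big_distrr /=; apply: leq_sum_nat => c lt_c.
rewrite -clause_runs_min; apply: leq_add.
- have := A4 eqx (2 * c) ltac:(lia); have := B4 eqy (2 * c) ltac:(lia).
  by rewrite flip0 flip1_even leq_min => -> ->.
- have := A4 eqx (2 * c).+1 ltac:(lia); have := B4 eqy (2 * c).+1 ltac:(lia).
  by rewrite flip0 flip1_odd leq_min => -> ->.
Qed.

(** * Lower bound on the length of the LCWIS *)

Definition floor2 (r x : nat) : nat := x %/ 2 ^ r * 2 ^ r.

Lemma floor2_le r x : floor2 r x <= x. Proof. exact: leq_trunc_div. Qed.

Lemma floor2_anti r r' x : r <= r' -> floor2 r' x <= floor2 r x.
Proof.
move=> /subnK <-; rewrite /floor2 expnD mulnA leq_mul2r; apply/orP; right.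
by rewrite [X in x %/ X]mulnC divnMA leq_trunc_div.
Qed.

(** [floor2 r x] is the last block up to [x] whose index is a multiple of [2 ^ r]. It is an odd
    multiple exactly when digit [r] of [x] is 1, so the even symbol contributes that digit. *)
Lemma sep_floor2_even W k x l : sep W k (floor2 (k.-1 - l) x) (2 * l) =
  W * (2 ^ (k.-1 - l) * (x %/ 2 ^ (k.-1 - l) %% 2)).
Proof.
rewrite /sep mulKn // modnMr /= -mulnA; congr (_ * (_ * _)).
rewrite /floor2 expnS -muln_modl; set r := k.-1 - l.
have : x %/ 2 ^ r %% 2 < 2 by rewrite ltn_mod.
case: (_ %% 2) => [|[|]] // _; rewrite ?mul1n ?eqxx // mul0n eq_sym.
by rewrite -leqn0 leqNgt expn_gt0.
Qed.

Lemma sep_floor2_odd W k x l : sep W k (floor2 (k.-1 - l) x) (2 * l).+1 =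
  W * 2 ^ (k.-1 - l).
Proof.
rewrite /sep (_ : (2 * l).+1 %/ 2 = l); last by lia.
rewrite (_ : (2 * l).+1 %% 2 = 1); last by lia.
by rewrite /floor2 modnMl muln1.
Qed.

(** Binary expansion, the most significant digit belonging to the first level. *)
Lemma sum_bits x k : x < 2 ^ k ->
  \sum_(0 <= l < k) 2 ^ (k.-1 - l) * (x %/ 2 ^ (k.-1 - l) %% 2) = x.
Proof.
have -> : \sum_(0 <= l < k) 2 ^ (k.-1 - l) * (x %/ 2 ^ (k.-1 - l) %% 2) =
    \sum_(0 <= r < k) 2 ^ r * (x %/ 2 ^ r %% 2).
  have := @sum_nat_rev (fun r => 2 ^ r * (x %/ 2 ^ r %% 2)) k 0 k.
  rewrite subnn subn0 leq0n leqnn => /(_ isT) <-.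
  by apply: eq_sum_nat => l _; rewrite subn1.
elim: k x => [|k IH] x lt_x; first by rewrite big_geq //; move: lt_x; rewrite expn0; lia.
rewrite big_nat_recl //= expn0 mul1n divn1.
under eq_bigr do rewrite expnS divnMA -mulnA.
by rewrite -big_distrr /= IH; [lia | rewrite expnS in lt_x; lia].
Qed.

Lemma sum_sep_bits W k x : x < 2 ^ k ->
  \sum_(0 <= l < k) sep W k (floor2 (k.-1 - l) x) (2 * l) = W * x.
Proof.
move=> lt_x; rewrite -[in RHS](sum_bits lt_x) big_distrr /=.
by apply: eq_bigr => l _; rewrite sep_floor2_even.
Qed.

(** The block that supplies the run of [v] when the middle part is read in block [i]: for a small
    separator the last block up to [i] at which its level occurs, for a large one the mirror image
    of this choice. *)
Definition run_block (k M i v : nat) : nat :=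
  if v < 2 * k then floor2 (k.-1 - v %/ 2) i
  else if v < 2 * k + 2 * M then i
  else 2 ^ k - 1 - floor2 (k.-1 - (4 * k + 2 * M - 1 - v) %/ 2) (2 ^ k - 1 - i).

Lemma run_block_mono k M i u v : i < 2 ^ k -> u <= v ->
  run_block k M i u <= run_block k M i v.
Proof.
move=> lt_i le_uv; rewrite /run_block.
have fl r := floor2_le r i; have fl' r := floor2_le r (2 ^ k - 1 - i).
case: (ltnP v (2 * k)) => hv.
  rewrite ifT; last by lia.
  by apply: floor2_anti; apply: leq_sub2l; apply: leq_div2r.
case: (ltnP v (2 * k + 2 * M)) => hv'.
  by case: (ltnP u (2 * k)) => hu; [apply: fl | rewrite ifT //; lia].
case: (ltnP u (2 * k)) => hu.
  by apply: leq_trans (fl _) _; have := fl' (k.-1 - (4 * k + 2 * M - 1 - v) %/ 2); lia.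
case: (ltnP u (2 * k + 2 * M)) => hu'.
  by have := fl' (k.-1 - (4 * k + 2 * M - 1 - v) %/ 2); lia.
apply: leq_sub2l; apply: floor2_anti; apply: leq_sub2l.
by apply: leq_div2r; apply: leq_sub2l.
Qed.

Lemma run_block_lt k M i v : i < 2 ^ k -> run_block k M i v < 2 ^ k.
Proof.
move=> lt_i; rewrite /run_block; case: ifP => _; last by case: ifP => _ //; lia.
exact: leq_ltn_trans (floor2_le _ _) lt_i.
Qed.

(** In each run the smaller of the two multiplicities is common. For a separator one side offers a
    binary digit times the weight and the other the full weight, so the minimum is the digit term,
    and these add up to [i] and [j]. *)
Lemma lcwis_lower k M tA tB i j : i < 2 ^ k -> j < 2 ^ k ->
  exists C, [/\ sorted leq C, subseq C (lcwis_side 0 k M tA),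
    subseq C (lcwis_side 1 k M tB) &
    size C = 12 * M * (2 ^ k - 1) + 2 * \sum_(0 <= c < M) (tA i c || tB j c)].
Proof.
move=> lt_i lt_j; set V := 4 * k + 2 * M.
pose mA v := mult k M tA (run_block k M i v) (flip 0 v).
pose mB v := mult k M tB (run_block k M j v) (flip 1 v).
exists (block V (fun v => minn (mA v) (mB v))); split.
- exact: sorted_block.
- apply: (@block_subseq_word _ _ _ _ (run_block k M i)) => [u v le_uv _|v _|v _].
  + exact: run_block_mono.
  + exact: run_block_lt.
  + exact: geq_minl.
- apply: (@block_subseq_word _ _ _ _ (run_block k M j)) => [u v le_uv _|v _|v _].
  + exact: run_block_mono.
  + exact: run_block_lt.
  + exact: geq_minr.
have half_even l : (2 * l) %/ 2 = l by lia.
have half_odd l : (2 * l).+1 %/ 2 = l by lia.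
have min_bit a x : minn (6 * M * (a * (x %% 2))) (6 * M * a) = 6 * M * (a * (x %% 2)).
  apply/minn_idPl; rewrite leq_mul2l -[leqRHS]muln1 leq_mul2l.
  by rewrite -[_ <= 1]ltnS ltn_mod !orbT.
rewrite size_block (_ : V = 2 * (2 * k + M)); last by rewrite /V; lia.
rewrite sum_pairs (@big_cat_nat _ _ _ k) //=; last by lia.
rewrite (@big_cat_nat _ _ _ (k + M) k) //=; [|lia|lia].
pose G l := minn (mA (2 * l)) (mB (2 * l)) + minn (mA (2 * l).+1) (mB (2 * l).+1).
have E1 : \sum_(0 <= l < k) G l = 6 * M * i + 6 * M * j.
  rewrite -(sum_sep_bits (6 * M) lt_i) -(sum_sep_bits (6 * M) lt_j) -big_split /=.
  apply: eq_sum_nat => l lt_l; rewrite /G /mA /mB !flip0 flip1_even flip1_odd.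
  rewrite /mult /run_block half_even half_odd !ifT; try lia.
  rewrite !sep_floor2_odd !sep_floor2_even min_bit; congr (_ + _).
  by rewrite minnC min_bit.
have E2 : \sum_(k <= l < k + M) G l = 2 * \sum_(0 <= c < M) (tA i c || tB j c).
  rewrite big_distrr /= -[LHS]/(\sum_(0 + k <= l < k + M) G l) big_addn addKn.
  apply: eq_sum_nat => c lt_c; rewrite /G /mA /mB !flip0 flip1_even flip1_odd.
  rewrite -clause_runs_min /mult /run_block.
  rewrite !(@ifF _ (_ < 2 * k)); try lia.
  rewrite !ifT; try lia.
  have -> : 2 * (c + k) - 2 * k = 2 * c by lia.
  by have -> : (2 * (c + k)).+1 - 2 * k = (2 * c).+1 by lia.
have E3 : \sum_(k + M <= l < 2 * k + M) G l =
    6 * M * (2 ^ k - 1 - i) + 6 * M * (2 ^ k - 1 - j).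
  have lt_i' : 2 ^ k - 1 - i < 2 ^ k by lia.
  have lt_j' : 2 ^ k - 1 - j < 2 ^ k by lia.
  rewrite -(sum_sep_bits (6 * M) lt_i') -(sum_sep_bits (6 * M) lt_j') -big_split /=.
  have := @sum_nat_rev (fun l => 
    sep (6 * M) k (floor2 (k.-1 - l) (2 ^ k - 1 - i)) (2 * l) +
    sep (6 * M) k (floor2 (k.-1 - l) (2 ^ k - 1 - j)) (2 * l)) (2 * k + M) (k + M) (2 * k + M).
  rewrite subnn (_ : 2 * k + M - (k + M) = k); last by lia.
  move=> <-; last by lia.
  apply: eq_big_nat => l lt_l; set l' := 2 * k + M - 1 - l.
  have el : l = 2 * k + M - 1 - l' by rewrite /l'; lia.
  have lt_l' : l' < k by rewrite /l'; lia.
  rewrite /G /mA /mB !flip0 flip1_even flip1_odd /mult /run_block.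
  have -> : 4 * k + 2 * M - 1 - 2 * l = (2 * l').+1 by lia.
  have -> : 4 * k + 2 * M - 1 - (2 * l).+1 = 2 * l' by lia.
  rewrite !half_even !half_odd !ifF; try lia.
  have fl x : 2 ^ k - 1 - (2 ^ k - 1 - floor2 (k.-1 - l') (2 ^ k - 1 - x)) =
      floor2 (k.-1 - l') (2 ^ k - 1 - x).
    by have := floor2_le (k.-1 - l') (2 ^ k - 1 - x); lia.
  by rewrite !fl !sep_floor2_odd !sep_floor2_even minnC !min_bit addnC.
transitivity (\sum_(0 <= l < k) G l + (\sum_(k <= l < k + M) G l
  + \sum_(k + M <= l < 2 * k + M) G l)); first by [].
rewrite E1 E2 E3.
have -> : 12 * M * (2 ^ k - 1) = 6 * M * (2 ^ k - 1) + 6 * M * (2 ^ k - 1).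
  by rewrite -mulnDl; congr (_ * _); lia.
have eq_i : 6 * M * (2 ^ k - 1) = 6 * M * i + 6 * M * (2 ^ k - 1 - i).
  by rewrite -mulnDr; congr (_ * _); lia.
have eq_j : 6 * M * (2 ^ k - 1) = 6 * M * j + 6 * M * (2 ^ k - 1 - j).
  by rewrite -mulnDr; congr (_ * _); lia.
rewrite {1}eq_i eq_j; clear; do !move: (6 * M * _); lia.
Qed.

(** * Lengths of the two sequences *)

Lemma clause_runs_pair t c : clause_runs t (2 * c) + clause_runs t (2 * c).+1 = 3.
Proof.
rewrite /clause_runs.
have -> : (2 * c) %% 2 = 0 by lia.
have -> : (2 * c).+1 %% 2 = 1 by lia.
have -> : (2 * c) %/ 2 = c by lia.
have -> : (2 * c).+1 %/ 2 = c by lia.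
by case: (t c).
Qed.

(** The LCWIS algorithm expects sequences of equal length. Separators do not depend on the table,
    and the two middle symbols of a clause occur 3 times together in every block, whatever the table
    says. *)
Lemma size_lcwis_side s s' k M t t' : s <= 1 -> s' <= 1 ->
  size (lcwis_side s k M t) = size (lcwis_side s' k M t').
Proof.
suff main u t1 t2 : u <= 1 ->
    size (lcwis_side u k M t1) = size (lcwis_side 0 k M t2).
  by move=> le_s le_s'; rewrite (main s t t) // (main s' t' t).
move=> le_u; rewrite !size_block_word; apply: eq_sum_nat => i _.
have -> : 4 * k + 2 * M = 2 * (2 * k + M) by lia.
rewrite !sum_pairs; apply: eq_sum_nat => l _.
have -> : mult k M t1 i (flip u (2 * l)) + mult k M t1 i (flip u (2 * l).+1) =
    mult k M t1 i (2 * l) + mult k M t1 i (2 * l).+1.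
  by case: u le_u => [|[|]] // _; rewrite ?flip0 // flip1_even flip1_odd addnC.
rewrite !flip0 /mult; have [lt_l|ge_l] := ltnP l k.
  by rewrite !ifT //; lia.
rewrite !(@ifF _ (_ < 2 * k)); try lia.
have [lt_lM|ge_lM] := ltnP l (k + M); last by rewrite !ifF //; lia.
rewrite !ifT; try lia.
have -> : 2 * l - 2 * k = 2 * (l - k) by lia.
have -> : (2 * l).+1 - 2 * k = (2 * (l - k)).+1 by lia.
by rewrite !clause_runs_pair.
Qed.

Lemma sum_multiples q d : 0 < d ->
  \sum_(0 <= i < q * d) (i %% d == 0) * d = q * d.
Proof.
move=> d_gt0; elim: q => [|q IH]; first by rewrite big_geq.
rewrite mulSn (@big_cat_nat _ _ _ (q * d)) //=; last by lia.
rewrite IH addnC; congr (_ + _).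
rewrite -{1}[q * d]add0n big_addn addnK big_ltn //= add0n modnMl eqxx mul1n.
rewrite big_nat_cond big1 ?addn0 // => i /andP[/andP[i_gt0 lt_i] _].
by rewrite addnC modnMDl modn_small //; case: eqP => // e; lia.
Qed.

(** There are [2 ^ (k - r)] multiples of [2 ^ r] below [2 ^ k], each carrying at most
    [W * 2 ^ r]. *)
Lemma sum_sep_le W k v : \sum_(0 <= i < 2 ^ k) sep W k i v <= W * 2 ^ k.
Proof.
set r := k.-1 - v %/ 2.
have le_rk : r <= k by rewrite /r; lia.
have := @sum_multiples (2 ^ (k - r)) (2 ^ r) (expn_gt0 _ _).
rewrite -expnD subnK // => eq_sum; rewrite -[in leqRHS]eq_sum big_distrr /=.
apply: leq_sum_nat => i _; rewrite /sep -/r -mulnA leq_mul2l.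
apply/orP; right; rewrite mulnC leq_mul2r; apply/orP; right.
case: (v %% 2 == 0) => //.
case: eqP => // e; rewrite (_ : i %% 2 ^ r = 0) //.
by rewrite -(modn_dvdm i (dvdn_exp2l 2 (leqnSn r))) e modnn.
Qed.

(** Since [k <= M] there are at most [6 * M] symbols, each occurring at most [6 * M.+1 * 2 ^ k]
    times. *)
Lemma size_lcwis_side_le s k M t : s <= 1 -> k <= M ->
  size (lcwis_side s k M t) <= 36 * M.+1 ^ 2 * 2 ^ k.
Proof.
move=> le_s le_kM; rewrite (@size_lcwis_side s 0 k M t t) // size_block_word.
rewrite exchange_big_nat /=; set V := 4 * k + 2 * M.
have bnd v : v < V -> \sum_(0 <= i < 2 ^ k) mult k M t i (flip 0 v) <=
    6 * M.+1 * 2 ^ k.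
  move=> lt_v; rewrite flip0 /mult; have [lt1|ge1] := ltnP v (2 * k).
    by apply: leq_trans (sum_sep_le _ _ _) _; rewrite leq_mul2r; lia.
  have [lt2|ge2] := ltnP v (2 * k + 2 * M).
    apply: (@leq_trans (\sum_(0 <= i < 2 ^ k) 3)).
      apply: leq_sum_nat => i _; rewrite /clause_runs.
      by case: ifP; case: ifP.
    by rewrite sum_nat_const_nat subn0 mulnC leq_mul2r; lia.
  rewrite (sum_nat_rev (fun i => sep (6 * M) k i (4 * k + 2 * M - 1 - v))) ?leqnn //.
  rewrite subnn subn0; apply: leq_trans (sum_sep_le _ _ _) _.
  by rewrite leq_mul2r; lia.
apply: (@leq_trans (\sum_(0 <= v < V) 6 * M.+1 * 2 ^ k)).
  by apply: leq_sum_nat => v; apply: bnd.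
rewrite sum_nat_const_nat subn0 mulnA leq_mul2r; apply/orP; right.
rewrite (_ : 36 * M.+1 ^ 2 = 6 * M.+1 * (6 * M.+1)); last by lia.
by rewrite leq_mul2r; apply/orP; right; rewrite /V; lia.
Qed.

(** * Half assignments *)

Lemma exists_bits (f : nat -> bool) h :
  exists2 a, a < 2 ^ h & forall i, i < h -> Nat.testbit a i = f i.
Proof.
elim: h f => [|h IH] f; first by exists 0.
have [a lt_a bits_a] := IH (fun i => f i.+1).
exists (f 0 + 2 * a); first by rewrite expnS; case: (f 0); lia.
case=> [|i] lt_i /=.
  rewrite /Nat.odd; case: (f 0); first by rewrite PeanoNat.Nat.even_add_mul_2.
  by rewrite add0n PeanoNat.Nat.even_mul.
rewrite -bits_a //; congr Nat.testbit; case: (f 0).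
  by rewrite add1n; exact: PeanoNat.Nat.div2_succ_double.
by rewrite add0n; exact: PeanoNat.Nat.div2_double.
Qed.

Section HalfAssignments.
Variables (N M : nat) (F : cnf N).

(** Rounded up, so that two halves cover all variables. *)
Definition half_vars : nat := (N + 1) %/ 2.

(* Side [s] owns the variables [s * half_vars <= i < s * half_vars + half_vars];
   bit [i - s * half_vars] of [a] is the value of variable [i]. *)
Definition half_sat_clause (s a : nat) (c : clause N) : bool :=
  has (fun l : literal N => (s * half_vars <= l.1 < s * half_vars + half_vars)
         && (Nat.testbit a (l.1 - s * half_vars) == l.2)) c.

Definition half_sat (s a c : nat) : bool := half_sat_clause s a (nth [::] F c).

(** The set of satisfied clauses among the first [n], as a binary number whose leading digit is
    clause 0. *)
Definition row_code (s a n : nat) : nat :=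
  foldl (fun x c => 2 * x + half_sat s a c) 0 (iota 0 n).

(* When there are fewer clauses than variables in a half, the half assignments are
   grouped by the set of clauses that they satisfy: this keeps the number of rows
   at most [2 ^ M]. *)
Definition row_index (s a : nat) : nat :=
  if M < half_vars then row_code s a M else a.

Definition row_table (s i c : nat) : bool :=
  has (fun a => (row_index s a == i) && half_sat s a c) (iota 0 (2 ^ half_vars)).

Lemma row_codeS s a n : row_code s a n.+1 = 2 * row_code s a n + half_sat s a n.
Proof. by rewrite /row_code -[n.+1]addn1 iotaD foldl_cat. Qed.

Lemma row_code_lt s a n : row_code s a n < 2 ^ n.
Proof.
elim: n => // n IH; rewrite row_codeS expnS; case: half_sat; lia.
Qed.

Lemma row_code_inj s a b n : row_code s a n = row_code s b n ->
  forall c, c < n -> half_sat s a c = half_sat s b c.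
Proof.
elim: n => // n IH; rewrite !row_codeS => e.
have eqn : half_sat s a n = half_sat s b n by move: e; do 2!case: half_sat; lia.
move=> c; rewrite ltnS leq_eqVlt => /orP[/eqP->//|]; apply: IH; lia.
Qed.

Lemma row_index_lt s a : a < 2 ^ half_vars -> row_index s a < 2 ^ minn half_vars M.
Proof.
rewrite /row_index; case: (ltnP M half_vars) => [lt_M|ge_M] lt_a //.
exact: row_code_lt.
Qed.

(** If some half assignment has index [i], the row is its set of clauses, because assignments with
    the same index satisfy the same clauses. Otherwise the row is empty and any assignment will
    do. *)
Lemma row_table_dominated s i :
  exists2 a, a < 2 ^ half_vars & forall c, c < M -> row_table s i c -> half_sat s a c.
Proof.
have [/hasP[a]|none] := boolP (has (fun a => row_index s a == i) (iota 0 (2 ^ half_vars))).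
  rewrite mem_iota add0n => /= lt_a /eqP eq_a; exists a => // c lt_c.
  case/hasP=> b _ /andP[/eqP eq_b]; suff -> : half_sat s a c = half_sat s b c by [].
  move: eq_b; rewrite -eq_a /row_index; case: (ltnP M half_vars) => _; last by move->.
  by move/esym/row_code_inj; apply.
exists 0 => [|c _ /hasP[b b_in /andP[eq_b _]]]; first by rewrite expn_gt0.
by case/hasP: none; exists b.
Qed.

Lemma row_table_index s a c : a < 2 ^ half_vars -> half_sat s a c ->
  row_table s (row_index s a) c.
Proof.
by move=> lt_a sat; apply/hasP; exists a; rewrite ?mem_iota ?eqxx.
Qed.

Lemma sat_clause_halves (x : {ffun 'I_N -> bool}) a b :
  (forall i : 'I_N, i < half_vars -> Nat.testbit a i = x i) ->
  (forall i : 'I_N, half_vars <= i -> Nat.testbit b (i - half_vars) = x i) ->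
  forall c, sat_clause x c = half_sat_clause 0 a c || half_sat_clause 1 b c.
Proof.
move=> bits_a bits_b c; rewrite /sat_clause /half_sat_clause -has_predU.
apply: eq_has => -[i v] /=; rewrite !mul0n add0n subn0 mul1n.
have lt_i := ltn_ord i.
have lt2 : i < half_vars + half_vars by rewrite /half_vars; lia.
rewrite lt2 andbT; have [lt_h|ge_h] := ltnP i half_vars.
  by rewrite bits_a // orbF.
by rewrite bits_b.
Qed.

Hypothesis size_F : size F = M.

Lemma count_sum (P : pred (clause N)) :
  count P F = \sum_(0 <= c < M) P (nth [::] F c).
Proof.
rewrite -size_F -(big_nth [::] xpredT (fun c => P c : nat)) -sum1_count big_mkcond.
by apply: eq_bigr => c _; case: (P c).
Qed.

(** Half assignments that dominate the two rows combine into one assignment of all variables. *)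
Lemma row_table_le_max_sat i j :
  \sum_(0 <= c < M) (row_table 0 i c || row_table 1 j c) <= max_sat F.
Proof.
have [a lt_a dom_a] := row_table_dominated 0 i.
have [b lt_b dom_b] := row_table_dominated 1 j.
pose x : {ffun 'I_N -> bool} := [ffun i : 'I_N =>
  if i < half_vars then Nat.testbit a i else Nat.testbit b (i - half_vars)].
apply: leq_trans (leq_bigmax x); rewrite count_sum.
apply: leq_sum_nat => c /andP[_ lt_c].
rewrite (@sat_clause_halves x a b) => [|k lt_k|k ge_k]; last first.
- by rewrite ffunE ifF //; lia.
- by rewrite ffunE lt_k.
have := dom_a c lt_c; have := dom_b c lt_c; rewrite /half_sat.
case: (row_table 0 i c); case: (row_table 1 j c) => //= db da.
- by rewrite da.
- by rewrite da.
- by rewrite db // orbT.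
Qed.

Lemma max_sat_le_row_table : exists i j,
  [/\ i < 2 ^ minn half_vars M, j < 2 ^ minn half_vars M &
   max_sat F <= \sum_(0 <= c < M) (row_table 0 i c || row_table 1 j c)].
Proof.
have [x max_x] : {x : {ffun 'I_N -> bool} | max_sat F = count (sat_clause x) F}.
  by apply: bigop.eq_bigmax; apply/card_gt0P; exists [ffun=> true].
pose f i := if insub i is Some k then x k else false.
have fE (i : 'I_N) : f i = x i by rewrite /f valK.
have [a lt_a bits_a] := exists_bits f half_vars.
have [b lt_b bits_b] := exists_bits (fun i => f (half_vars + i)) half_vars.
exists (row_index 0 a), (row_index 1 b); rewrite !row_index_lt //; split=> //.
rewrite max_x count_sum; apply: leq_sum_nat => c _.
rewrite (@sat_clause_halves x a b) => [|k lt_k|k ge_k]; last first.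
- by rewrite bits_b ?subnKC ?fE //; have := ltn_ord k; rewrite /half_vars in ge_k *; lia.
- by rewrite bits_a ?fE.
have := @row_table_index 0 a c lt_a; have := @row_table_index 1 b c lt_b.
rewrite /half_sat.
case: (half_sat_clause 0 a _); case: (half_sat_clause 1 b _) => //= tb ta.
- by rewrite ta.
- by rewrite ta.
- by rewrite tb // orbT.
Qed.

Lemma lcwis_sides_length :
  let k := minn half_vars M in
  is_LCWIS_length (lcwis_side 0 k M (row_table 0)) (lcwis_side 1 k M (row_table 1))
    (12 * M * (2 ^ k - 1) + 2 * max_sat F).
Proof.
move=> k; split=> [|C [sortC subA subB]]; last first.
  have [i [j [lt_i lt_j le_C]]] := lcwis_upper sortC subA subB.
  apply: leq_trans le_C _; rewrite leq_add2l leq_mul2l /=.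
  exact: row_table_le_max_sat.
have [i [j [lt_i lt_j le_max]]] := max_sat_le_row_table.
have [C [sortC subA subB szC]] := lcwis_lower M (row_table 0) (row_table 1) lt_i lt_j.
exists C; first by split.
rewrite szC; congr (_ + 2 * _); apply/eqP; rewrite eqn_leq le_max.
by rewrite row_table_le_max_sat.
Qed.

End HalfAssignments.

(** * Bitwise operations *)

Lemma powE a n : Nat.pow a n = a ^ n.
Proof. by elim: n => //= n ->; rewrite expnS. Qed.

Lemma shiftlE a n : Nat.shiftl a n = a * 2 ^ n.
Proof. by rewrite PeanoNat.Nat.shiftl_mul_pow2 powE. Qed.

Lemma ltn_pow2_bits a n :
  a < 2 ^ n <-> forall i, n <= i -> Nat.testbit a i = false.
Proof.
split=> [lt_a i le_ni|bits].
  have lt_a' : lt a (Nat.pow 2 n) by rewrite powE; apply/ssrnat.ltP.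
  rewrite -(PeanoNat.Nat.mod_small _ _ lt_a').
  exact/PeanoNat.Nat.mod_pow2_bits_high/ssrnat.leP.
have e : Nat.modulo a (Nat.pow 2 n) = a.
  apply: PeanoNat.Nat.bits_inj => i; have [lt_i|le_i] := ltnP i n.
    exact/PeanoNat.Nat.mod_pow2_bits_low/ssrnat.ltP.
  by rewrite bits // PeanoNat.Nat.mod_pow2_bits_high //; apply/ssrnat.leP.
apply/ssrnat.ltP; rewrite -e -powE; apply: PeanoNat.Nat.mod_upper_bound.
exact: PeanoNat.Nat.pow_nonzero.
Qed.

Lemma lor_lt a b n : a < 2 ^ n -> b < 2 ^ n -> Nat.lor a b < 2 ^ n.
Proof.
move=> /ltn_pow2_bits ha /ltn_pow2_bits hb; apply/ltn_pow2_bits => i le_i.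
by rewrite PeanoNat.Nat.lor_spec ha ?hb.
Qed.

Lemma lxor_lt a b n : a < 2 ^ n -> b < 2 ^ n -> Nat.lxor a b < 2 ^ n.
Proof.
move=> /ltn_pow2_bits ha /ltn_pow2_bits hb; apply/ltn_pow2_bits => i le_i.
by rewrite PeanoNat.Nat.lxor_spec ha ?hb.
Qed.

Lemma land_lt a b n : a < 2 ^ n -> Nat.land a b < 2 ^ n.
Proof.
move=> /ltn_pow2_bits ha; apply/ltn_pow2_bits => i le_i.
by rewrite PeanoNat.Nat.land_spec ha.
Qed.

Lemma neq0_testbit a : a <> 0 -> exists i, Nat.testbit a i.
Proof.
move=> nz; exists (PeanoNat.Nat.log2 a); exact: PeanoNat.Nat.bit_log2.
Qed.

(** * A calculus for programs with variables and expressions *)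

(** A layer above the word RAM. Variable [x] lives in register [K + x], temporaries in the registers
    from [K + nvars] on, and the registers below [K] stay 0 for the LCWIS program. *)
Inductive expr :=
  | Var of nat
  | Cst of nat
  | Bin of binop & expr & expr
  | Fetch of expr.

Declare Scope expr_scope.
Delimit Scope expr_scope with expr.
Bind Scope expr_scope with expr.
Notation "a + b" := (Bin OpAdd a b) : expr_scope.
Notation "a - b" := (Bin OpSub a b) : expr_scope.
Notation "a * b" := (Bin OpMul a b) : expr_scope.
Notation "a %/ b" := (Bin OpDiv a b) : expr_scope.
Notation "a %% b" := (Bin OpMod a b) : expr_scope.
Notation "a == b" := (Bin OpEq a b) : expr_scope.
Notation "a < b" := (Bin OpLt a b) : expr_scope.
Notation "'1<<' b" := (Bin OpShl (Cst 1) b)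
  (at level 35, b at level 9) : expr_scope.

Fixpoint eval_expr (e : expr) (rho : seq nat) (m : nat -> nat) : nat :=
  match e with
  | Var x => nth 0 rho x
  | Cst v => v
  | Bin o a b => eval_binop o (eval_expr a rho m) (eval_expr b rho m)
  | Fetch a => m (eval_expr a rho m)
  end.

Fixpoint cost (e : expr) : nat :=
  match e with
  | Var _ | Cst _ => 1
  | Bin _ a b => cost a + (cost b + 1)
  | Fetch a => cost a + 1
  end.

Definition nvars := 24.

(* An upper bound, in units of [l] bits, on the size of the value of an
   expression when variables and memory cells have at most [16 * l] bits and
   shifts are by at most [2 * l]. *)
Fixpoint bits (e : expr) : nat :=
  match e with
  | Var _ | Fetch _ => 16
  | Cst v => v
  | Bin o a b =>
    match o with
    | OpAdd => (maxn (bits a) (bits b)).+1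
    | OpMul => bits a + bits b
    | OpSub | OpDiv | OpMod | OpAnd | OpShr => bits a
    | OpOr | OpXor => maxn (bits a) (bits b)
    | OpShl => bits a + 2
    | OpEq | OpLt => 1
    end
  end.

(** A condition settled by computation. The 64 matches the hypothesis [l * 64 <= w], so that every
    intermediate value fits in a word. *)
Fixpoint fits (e : expr) : bool :=
  match e with
  | Var x => x < nvars
  | Cst v => v <= 64
  | Fetch a => fits a
  | Bin o a b =>
    [&& fits a, fits b, bits (Bin o a b) <= 64 & if o is OpShr then false else true]
  end.

Section Calculus.
Variables (K l w : nat).
Hypotheses (l_gt0 : 0 < l) (lw : l * 64 <= w).

(** A left shift is the one operation for which the sizes of the operands do not control the size of
    the result, so it needs a condition on values. *)
Fixpoint small_shifts (e : expr) (rho : seq nat) (m : nat -> nat) : Prop :=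
  match e with
  | Var _ | Cst _ => True
  | Fetch a => small_shifts a rho m
  | Bin OpShl a b =>
    [/\ small_shifts a rho m, small_shifts b rho m & eval_expr b rho m <= 2 * l]
  | Bin _ a b => small_shifts a rho m /\ small_shifts b rho m
  end.

(** Stored values keep to [16 * l] bits; words are at least four times as long, which leaves room
    for intermediate values. *)
Definition word_bound := 2 ^ (l * 16).

Lemma eval_expr_lt rho m :
  (forall x, nth 0 rho x < word_bound) -> (forall a, m a < word_bound) ->
  forall e, fits e -> small_shifts e rho m -> eval_expr e rho m < 2 ^ (l * bits e).
Proof.
move=> lt_rho lt_m; elim=> [x|v|o a IHa b IHb|a IHa] //=.
- move=> _ _; apply: leq_trans (ltn_expl v (ltnSn 1)) _.
  by rewrite leq_exp2l // leq_pmull.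
- case/and4P=> fa fb _ ok_o sh.
  have /IHa {}IHa := fa; have /IHb {}IHb := fb.
  have mono x y z : x < 2 ^ (l * y) -> y <= z -> x < 2 ^ (l * z).
    move=> lt_x le_yz; apply: leq_trans lt_x _.
    by rewrite leq_exp2l // leq_mul2l le_yz orbT.
  have pow_b (c : bool) : c < 2 ^ (l * 1).
    apply: (@leq_trans (2 ^ 1)); first by case: c.
    by rewrite leq_exp2l // muln1.
  case: o ok_o sh => //= _ [].
  + move=> /IHa ha /IHb hb.
    have {}ha := mono _ _ _ ha (leq_maxl _ (bits b)).
    have {}hb := mono _ _ _ hb (leq_maxr (bits a) _).
    apply: (@leq_trans (2 ^ (l * maxn (bits a) (bits b) + 1))).
      by rewrite expnD expn1; lia.
    by rewrite leq_exp2l // mulnS addnC leq_add2r.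
  + by move=> /IHa ha _; apply: leq_ltn_trans ha; apply: leq_subr.
  + by move=> /IHa ha /IHb hb; rewrite mulnDr expnD ltn_mul.
  + by move=> /IHa ha _; apply: leq_ltn_trans ha; apply: leq_div.
  + by move=> /IHa ha _; apply: leq_ltn_trans ha; apply: leq_mod.
  + by move=> /IHa ha _; apply: land_lt.
  + move=> /IHa ha /IHb hb; apply: lor_lt.
      exact: mono ha (leq_maxl _ _).
    exact: mono hb (leq_maxr _ _).
  + move=> /IHa ha /IHb hb; apply: lxor_lt.
      exact: mono ha (leq_maxl _ _).
    exact: mono hb (leq_maxr _ _).
  + move=> /IHa ha _ sh; rewrite shiftlE mulnDr expnD.
    apply: (@leq_trans (2 ^ (l * bits a) * 2 ^ eval_expr b rho m)).
      by rewrite ltn_mul2r ha expn_gt0.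
    by rewrite leq_mul2l leq_exp2l // (mulnC l 2) sh orbT.
Qed.

(** The registers from [d] on act as an evaluation stack. A variable is copied by [OpOr] of its
    register with itself. *)
Fixpoint compile (e : expr) (d : nat) : cmd :=
  match e with
  | Var x => Op OpOr d (K + x) (K + x)
  | Cst v => Const d v
  | Bin o a b => Seq (compile a d) (Seq (compile b d.+1) (Op o d d d.+1))
  | Fetch a => Seq (compile a d) (ReadMem d d)
  end.

Lemma compile_exec rho m :
  (forall x, nth 0 rho x < word_bound) -> (forall a, m a < word_bound) ->
  forall e, fits e -> small_shifts e rho m ->
  forall d s, K + nvars <= d ->
    (forall x, x < nvars -> regs s (K + x) = nth 0 rho x) -> mem s =1 m ->
  exists s', [/\ exec w (compile e d) s (cost e) s', regs s' d = eval_expr e rho m,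
    forall r, r < d -> regs s' r = regs s r & mem s' = mem s].
Proof.
move=> lt_rho lt_m.
have bound_w v : v < word_bound -> v < 2 ^ w.
  by move=> lt_v; apply: leq_trans lt_v _; rewrite leq_exp2l //; lia.
elim=> [x|v|o a IHa b IHb|a IHa] /=.
- move=> lt_x _ d s le_d Hs Hm; exists (set_reg s d (nth 0 rho x)); split=> //=.
  + rewrite -Hs // -{1}[regs s (K + x)]PeanoNat.Nat.lor_diag.
    by apply: ExecOp; rewrite /= PeanoNat.Nat.lor_diag Hs //; apply: bound_w.
  + by rewrite upd_same.
  + by move=> r lt_r; rewrite upd_other //; lia.
- move=> le_v _ d s le_d Hs Hm; exists (set_reg s d v); split=> //=.
  + apply: ExecConst; apply: leq_trans (ltn_expl v (ltnSn 1)) _.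
    by rewrite leq_exp2l //; apply: leq_trans lw; apply: leq_trans le_v _; lia.
  + by rewrite upd_same.
  + by move=> r lt_r; rewrite upd_other //; lia.
- move=> fit sh d s le_d Hs Hm.
  have lt_v := @eval_expr_lt rho m lt_rho lt_m (Bin o a b) fit sh.
  case/and4P: fit => fa fb le_bits _.
  have [sha shb] : small_shifts a rho m /\ small_shifts b rho m.
    by case: o sh {lt_v le_bits} => -[].
  have [s1 [E1 V1 R1 M1]] := IHa fa sha d s le_d Hs Hm.
  have [||s2 [E2 V2 R2 M2]] := IHb fb shb d.+1 s1 (leqW le_d).
  + by move=> x lt_x; rewrite R1 ?Hs //; lia.
  + by rewrite M1.
  have eo : eval_binop o (regs s2 d) (regs s2 d.+1) =
      eval_binop o (eval_expr a rho m) (eval_expr b rho m) by rewrite V2 R2 ?V1.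
  exists (set_reg s2 d (eval_binop o (eval_expr a rho m) (eval_expr b rho m))); split=> /=.
  + apply: ExecSeq E1 _; apply: ExecSeq E2 _; rewrite -eo; apply: ExecOp.
    rewrite eo; apply: leq_trans lt_v _; rewrite leq_exp2l //.
    by apply: leq_trans lw; rewrite leq_mul2l le_bits orbT.
  + by rewrite upd_same.
  + by move=> r lt_r; rewrite upd_other ?R2 ?R1 //; lia.
  + by rewrite M2.
- move=> fa sha d s le_d Hs Hm.
  have [s1 [E1 V1 R1 M1]] := IHa fa sha d s le_d Hs Hm.
  have em : mem s1 (regs s1 d) = m (eval_expr a rho m) by rewrite M1 V1 Hm.
  exists (set_reg s1 d (m (eval_expr a rho m))); split=> //=.
  + by apply: ExecSeq E1 _; rewrite -em; apply: ExecReadMem; rewrite em bound_w.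
  + by rewrite upd_same.
  + by move=> r lt_r; rewrite upd_other ?R1 //; lia.
Qed.

Definition tmp := K + nvars.
Definition assign x e := Seq (compile e tmp) (Op OpOr (K + x) tmp tmp).
Definition store a e :=
  Seq (compile a tmp) (Seq (compile e tmp.+1) (WriteMem tmp tmp.+1)).
Definition cond e p q := Seq (compile e tmp) (If tmp p q).
Definition loop e p := Seq (compile e tmp) (While tmp (Seq p (compile e tmp))).
Definition for_ x e p :=
  Seq (assign x (Cst 0)) (loop (Var x < e)%expr (Seq p (assign x (Var x + Cst 1)%expr))).

Definition represents (s : state) (rho : seq nat) (m : nat -> nat) : Prop :=
  [/\ forall x, x < nvars -> regs s (K + x) = nth 0 rho x, mem s =1 m,
      forall r, r < K -> regs s r = 0, forall x, nth 0 rho x < word_bound &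
      forall a, m a < word_bound].

(** Total correctness within time [T], phrased with variable contents and memory instead of machine
    states. *)
Definition wp (p : cmd) (rho : seq nat) (m : nat -> nat) (T : nat)
    (Q : seq nat -> (nat -> nat) -> Prop) : Prop :=
  forall s, represents s rho m ->
  exists t s' rho' m', [/\ exec w p s t s', t <= T, represents s' rho' m' & Q rho' m'].

Lemma wp_weaken p rho m T T' (Q Q' : seq nat -> (nat -> nat) -> Prop) :
  wp p rho m T Q -> T <= T' -> (forall rho' m', Q rho' m' -> Q' rho' m') ->
  wp p rho m T' Q'.
Proof.
move=> H le_T QQ' s /H[t [s' [rho' [m' [E le_t R q]]]]].
by exists t, s', rho', m'; split=> //; [apply: leq_trans le_T | apply: QQ'].
Qed.

Lemma wp_time p rho m T T' Q : wp p rho m T Q -> T <= T' -> wp p rho m T' Q.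
Proof. by move=> H le_T; apply: wp_weaken H le_T _. Qed.

Lemma wp_seq p q rho m T1 T2 Q :
  wp p rho m T1 (fun rho' m' => wp q rho' m' T2 Q) -> wp (Seq p q) rho m (T1 + T2) Q.
Proof.
move=> H s /H[t1 [s1 [rho1 [m1 [E1 le1 R1 H1]]]]].
have [t2 [s2 [rho2 [m2 [E2 le2 R2 q2]]]]] := H1 _ R1.
by exists (t1 + t2), s2, rho2, m2; split=> //; [apply: ExecSeq E1 E2 | apply: leq_add].
Qed.

Lemma wp_assign x e rho m (Q : seq nat -> (nat -> nat) -> Prop) :
  x < nvars -> fits e -> small_shifts e rho m -> eval_expr e rho m < word_bound ->
  Q (set_nth 0 rho x (eval_expr e rho m)) m -> wp (assign x e) rho m (cost e + 1) Q.
Proof.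
move=> lt_x fe sh lt_v q s [Rv Rm R0 Bv Bm].
have [s1 [E1 V1 R1 M1]] := compile_exec Bv Bm fe sh (leqnn _) Rv Rm.
exists (cost e + 1), (set_reg s1 (K + x) (eval_expr e rho m)),
  (set_nth 0 rho x (eval_expr e rho m)), m; split=> //.
- apply: ExecSeq E1 _; rewrite -V1 -{1}[regs s1 tmp]PeanoNat.Nat.lor_diag.
  apply: ExecOp; rewrite /= PeanoNat.Nat.lor_diag V1.
  by apply: leq_trans lt_v _; rewrite leq_exp2l //; lia.
- split=> //= [y lt_y||r lt_r|y].
  + rewrite nth_set_nth /= /upd eqn_add2l; case: eqP => // _.
    by rewrite R1 ?Rv //; lia.
  + by rewrite M1.
  + by rewrite upd_other ?R1 ?R0 //; lia.
  + by rewrite nth_set_nth /=; case: eqP.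
Qed.

Lemma wp_store a e rho m (Q : seq nat -> (nat -> nat) -> Prop) :
  fits a -> fits e -> small_shifts a rho m -> small_shifts e rho m ->
  eval_expr e rho m < word_bound ->
  Q rho (upd m (eval_expr a rho m) (eval_expr e rho m)) ->
  wp (store a e) rho m (cost a + (cost e + 1)) Q.
Proof.
move=> fa fe sha she lt_v q s [Rv Rm R0 Bv Bm].
have [s1 [E1 V1 R1 M1]] := compile_exec Bv Bm fa sha (leqnn _) Rv Rm.
have [||s2 [E2 V2 R2 M2]] := @compile_exec _ _ Bv Bm _ fe she tmp.+1 s1 (leqW (leqnn _)).
- by move=> x lt_x; rewrite R1 ?Rv //; lia.
- by rewrite M1.
exists (cost a + (cost e + 1)), (set_mem s2 (eval_expr a rho m) (eval_expr e rho m)), rho,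
  (upd m (eval_expr a rho m) (eval_expr e rho m)); split=> //.
- apply: ExecSeq E1 _; apply: ExecSeq E2 _.
  by rewrite -V2 -V1 -(R2 tmp) //; apply: ExecWriteMem.
- split=> //= [x lt_x|x|r lt_r|x].
  + by rewrite R2 ?R1 ?Rv // /tmp; lia.
  + by rewrite /upd M2 M1 Rm.
  + by rewrite R2 ?R1 ?R0 // /tmp; lia.
  + by rewrite /upd; case: ifP.
Qed.

Lemma compile_represents e rho m s : fits e -> small_shifts e rho m ->
  represents s rho m -> exists s', [/\ exec w (compile e tmp) s (cost e) s',
    regs s' tmp = eval_expr e rho m & represents s' rho m].
Proof.
move=> fe sh [Rv Rm R0 Bv Bm].
have [s1 [E1 V1 R1 M1]] := compile_exec Bv Bm fe sh (leqnn _) Rv Rm.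
exists s1; split=> //; split=> // [x lt_x||r lt_r].
- by rewrite R1 ?Rv //; lia.
- by rewrite M1.
- by rewrite R1 ?R0 //; lia.
Qed.

Lemma wp_cond e p q rho m T Q :
  fits e -> small_shifts e rho m ->
  (eval_expr e rho m <> 0 -> wp p rho m T Q) -> (eval_expr e rho m = 0 -> wp q rho m T Q) ->
  wp (cond e p q) rho m (cost e + T.+1) Q.
Proof.
move=> fe sh Hp Hq s R.
have [s1 [E1 V1 R1]] := compile_represents fe sh R.
have [z|nz] := eqVneq (eval_expr e rho m) 0.
- have [t [s2 [rho2 [m2 [E2 le2 R2 q2]]]]] := Hq z _ R1.
  exists (cost e + t.+1), s2, rho2, m2; split=> //; last by rewrite leq_add2l.
  by apply: ExecSeq E1 _; apply: ExecIfFalse => //; rewrite V1.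
- have [t [s2 [rho2 [m2 [E2 le2 R2 q2]]]]] := Hp (elimN eqP nz) _ R1.
  exists (cost e + t.+1), s2, rho2, m2; split=> //; last by rewrite leq_add2l.
  by apply: ExecSeq E1 _; apply: ExecIfTrue => //; rewrite V1; apply/eqP.
Qed.

Lemma wp_skip rho m (Q : seq nat -> (nat -> nat) -> Prop) :
  Q rho m -> wp Skip rho m 0 Q.
Proof. by move=> q s R; exists 0, s, rho, m; split=> //; apply: ExecSkip. Qed.

(** The number [n] of iterations is fixed in advance and [Tb] may vary with the iteration, so that
    nested loops can be charged to the length of what they write. *)
Lemma wp_loop n (I : nat -> seq nat -> (nat -> nat) -> Prop) Tb e p rho m
    (Q : seq nat -> (nat -> nat) -> Prop) :
  fits e -> (forall rho' m', small_shifts e rho' m') -> I 0 rho m ->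
  (forall i rho' m', i < n -> I i rho' m' ->
     eval_expr e rho' m' <> 0 /\ wp p rho' m' (Tb i) (I i.+1)) ->
  (forall rho' m', I n rho' m' -> eval_expr e rho' m' = 0 /\ Q rho' m') ->
  wp (loop e p) rho m (\sum_(0 <= i < n) (Tb i + cost e + 1) + cost e + 1) Q.
Proof.
move=> fe sh I0 step final s R.
have [s1 [E1 V1 R1]] := compile_represents fe (sh _ _) R.
suff [t [s2 [rho2 [m2 [E2 le2 R2 q2]]]]] : exists t s' rho' m',
    [/\ exec w (While tmp (Seq p (compile e tmp))) s1 t s',
        t <= \sum_(0 <= i < n) (Tb i + cost e + 1) + 1,
        represents s' rho' m' & Q rho' m'].
  exists (cost e + t), s2, rho2, m2; split=> //; first exact: ExecSeq E1 E2.
  by lia.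
have : forall d i rho m s, i + d = n -> I i rho m ->
    represents s rho m -> regs s tmp = eval_expr e rho m ->
  exists t s' rho' m', [/\ exec w (While tmp (Seq p (compile e tmp))) s t s',
    t <= \sum_(i <= j < n) (Tb j + cost e + 1) + 1,
    represents s' rho' m' & Q rho' m']; last first.
  by move/(_ n 0 rho m s1 (add0n n) I0 R1 V1).
elim=> [|d IH] i rho1 m1 s' eq_n Ii Rs' Vs'.
  rewrite addn0 in eq_n; rewrite eq_n in Ii *.
  have [z q] := final _ _ Ii.
  exists 1, s', rho1, m1; split=> //; last by rewrite big_geq.
  by apply: ExecWhileFalse; rewrite Vs'.
have lt_i : i < n by lia.
have [nz body] := step _ _ _ lt_i Ii.
have [t2 [s2 [rho2 [m2 [E2 le2 R2 I2]]]]] := body _ Rs'.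
have [s3 [E3 V3 R3]] := compile_represents fe (sh _ _) R2.
have [|t4 [s4 [rho4 [m4 [E4 le4 R4 q4]]]]] := IH i.+1 rho2 m2 s3 _ I2 R3 V3; first by lia.
exists ((t2 + cost e) + t4).+1, s4, rho4, m4; split=> //.
- by apply: ExecWhileTrue E4; [rewrite Vs' | apply: ExecSeq E2 E3].
- by rewrite big_ltn //; lia.
Qed.

(** The 7 and the 5 count the comparison, loop test, increment and initialisation of the counter.
    The body must preserve the counter, and [I i.+1] is required only after the increment. *)
Lemma wp_for n (I : nat -> seq nat -> (nat -> nat) -> Prop) Tb x e p rho m
    (Q : seq nat -> (nat -> nat) -> Prop) :
  x < nvars -> fits e -> (forall rho' m', small_shifts e rho' m') ->
  n < word_bound ->
  I 0 (set_nth 0 rho x 0) m ->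
  (forall i rho' m', I i rho' m' -> nth 0 rho' x = i /\ eval_expr e rho' m' = n) ->
  (forall i rho' m', i < n -> I i rho' m' ->
     wp p rho' m' (Tb i) (fun rho'' m'' =>
       nth 0 rho'' x = i /\ I i.+1 (set_nth 0 rho'' x i.+1) m'')) ->
  (forall rho' m', I n rho' m' -> Q rho' m') ->
  wp (for_ x e p) rho m (\sum_(0 <= i < n) (Tb i + cost e + 7) + cost e + 5) Q.
Proof.
move=> lt_x fe sh lt_n I0 Ix step final.
have -> : \sum_(0 <= i < n) (Tb i + cost e + 7) + cost e + 5 =
    (1 + 1) + (\sum_(0 <= i < n) (Tb i + 4 + cost (Var x < e)%expr + 1)
      + cost (Var x < e)%expr + 1).
  rewrite (_ : \sum_(0 <= i < n) (Tb i + cost e + 7) =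
    \sum_(0 <= i < n) (Tb i + 4 + cost (Var x < e)%expr + 1)).
    by rewrite /=; lia.
  by apply: eq_bigr => i _ /=; lia.
apply: wp_seq; apply: wp_assign => //; first by rewrite /= expn_gt0.
apply: (@wp_loop n I (fun i => Tb i + 4)) => //=.
- by rewrite lt_x fe.
- move=> i rho' m' lt_i Ii; have [-> ->] := Ix _ _ _ Ii; rewrite lt_i; split=> //.
  apply: wp_seq; apply: wp_weaken (step _ _ _ lt_i Ii) (leqnn _) _.
  move=> rho2 m2 [x2 I2]; apply: (@wp_assign x (Var x + Cst 1)%expr) => //=.
  + by rewrite lt_x.
  + by rewrite x2 addn1; apply: leq_ltn_trans lt_n.
  + by rewrite x2 addn1.
- by move=> rho' m' In; have [-> ->] := Ix _ _ _ In; rewrite ltnn; split=> //; apply: final.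
Qed.

End Calculus.

(** * The reduction program *)

(* Variables 0 to 9 hold, in this order, the values listed in the notation [env]
   below; variables 10 to 20 are local. *)
Definition init_prog K : cmd :=
  Seq (assign K 0 (Fetch (Cst 0))) (
  Seq (assign K 1 (Fetch (Cst 1))) (
  Seq (assign K 2 ((Var 0 + Cst 1) %/ Cst 2)%expr) (
  Seq (assign K 3 (Cst 2 + Var 1 * (Cst 2 * Var 0 + Cst 1))%expr) (
  Seq (assign K 4 (Var 2 - (Var 2 - Var 1))%expr) (
  Seq (assign K 5 (1<< (Var 4))%expr) (
  Seq (assign K 6 (Var 3 + Cst 2 * Var 1)%expr) (
  Seq (assign K 7 (Var 6 + Cst 2 * (Var 5 * Var 1))%expr) (
  Seq (assign K 8 (1<< (Var 2))%expr) (
       assign K 9 (Cst 4 * Var 4 + Cst 2 * Var 1)%expr))))))))).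

Definition mask_addr : expr := (Var 3 + (Cst 2 * Var 11 + Var 14 %% Cst 2))%expr.

(** Variable 10 is the reading position, 11 the clause, 12 its length, 13 the position in the clause
    and 14 the code of the literal, whose parity is the sign. *)
Definition parse_prog K : cmd :=
  Seq (assign K 10 (Cst 2)) (
  for_ K 11 (Var 1) (
    Seq (assign K 12 (Fetch (Var 10))) (
    Seq (assign K 10 (Var 10 + Cst 1)%expr) (
    for_ K 13 (Var 12) (
      Seq (assign K 14 (Fetch (Var 10))) (
      Seq (store K mask_addr
        (Bin OpOr (Fetch mask_addr) (1<< (Var 14 %/ Cst 2)))%expr)
      (assign K 10 (Var 10 + Cst 1)%expr))))))).

Definition mask_update N (b : bool) (acc : nat) (x : literal N) : nat :=
  if x.2 == b then Nat.lor acc (Nat.shiftl 1 x.1) else acc.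

(** The set of variables occurring in [c] with sign [b], as a bit vector; two such words replace the
    clause. *)
Definition clause_mask N (b : bool) (c : clause N) : nat := foldl (@mask_update N b) 0 c.

(** Memory layout: the encoded formula, at most [2 + M * (2 * N + 1)] cells since a clause has at
    most [2 * N] literals; two masks for each clause; a table of [2 ^ log_rows N M * M] bits for
    each half; the LCWIS instance. *)
Definition mask_base N M := 2 + M * (2 * N + 1).
Definition log_rows N M := minn (half_vars N) M.
Definition table_base N M := mask_base N M + 2 * M.
Definition instance_base N M := table_base N M + 2 * (2 ^ log_rows N M * M).
Definition alphabet N M := 4 * log_rows N M + 2 * M.

Lemma half_vars_le N : half_vars N <= N. Proof. rewrite /half_vars; lia. Qed.

Lemma log_rows_le N M : log_rows N M <= half_vars N. Proof. exact: geq_minl. Qed.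

(** With [X = 2 ^ l] the left side is below [128 * X ^ 3], and [X ^ 13] exceeds 128 because
    [X >= 2]. *)
Lemma instance_fits l N M : N < l -> M < 2 ^ l ->
  instance_base N M + 72 * M.+1 ^ 2 * 2 ^ log_rows N M + 2 ^ half_vars N + 4
  < word_bound l.
Proof.
move=> lt_Nl lt_Ml; set X := 2 ^ l.
have le_hX : 2 ^ half_vars N <= X by rewrite leq_exp2l //; have := half_vars_le N; lia.
have le_HX : 2 ^ log_rows N M <= X.
  by apply: leq_trans le_hX; rewrite leq_exp2l // log_rows_le.
have lt_NX : N < X by apply: ltn_trans (ltn_expl N (ltnSn 1)) _; rewrite ltn_exp2l.
have X_ge2 : 2 <= X by rewrite -[2]expn1 leq_exp2l //; lia.
have -> : word_bound l = X ^ 3 * X ^ 13 by rewrite /word_bound expnM -expnD.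
apply: (@leq_trans (X ^ 3 * 128)); last first.
  rewrite leq_mul2l -[128]/(2 ^ 7); apply/orP; right.
  by apply: (@leq_trans (2 ^ 13)); rewrite ?leq_exp2l ?leq_exp2r.
have H2 : 2 ^ log_rows N M * M <= X * X by apply: leq_mul => //; lia.
have H1 : M * (2 * N + 1) <= X * (2 * X) by apply: leq_mul; lia.
have H3 : M.+1 ^ 2 * 2 ^ log_rows N M <= X ^ 2 * X by apply: leq_mul; rewrite ?leq_exp2r.
rewrite /instance_base /table_base /mask_base -[72 * _ * _]mulnA.
have : X * X <= X ^ 3 by rewrite !expnS expn0 muln1 leq_mul2l leq_pmull ?orbT; lia.
have : X ^ 2 * X = X ^ 3 by rewrite -expnSr.
have : X <= X * X by rewrite leq_pmulr; lia.
have H1' : M * (2 * N + 1) <= 2 * (X * X) by move: H1; rewrite mulnCA.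
move: (X ^ 2 * X) (X ^ 3) (X * X) (_ * M) (_ ^ 2 * _) (M * _) H1' H2 H3.
move: (2 ^ log_rows N M) (2 ^ half_vars N) le_hX le_HX; lia.
Qed.

Section Reduction.
Variables (K l w N M : nat) (F : cnf N).
Hypotheses (size_F : size F = M) (wf_F : wf_cnf F).
Hypotheses (lw : l * 64 <= w) (lt_Nl : N < l) (lt_Ml : M < 2 ^ l).

Notation env locals := [:: N, M, half_vars N, mask_base N M,
  log_rows N M, 2 ^ log_rows N M, table_base N M, instance_base N M,
  2 ^ half_vars N, alphabet N M & locals].

Let l_gt0 : 0 < l. Proof. lia. Qed.

(** Makes the bounds contained in [represents] available while a [wp] is being proved. *)
Lemma wp_bounds p rho m T Q :
  ((forall a, m a < word_bound l) -> (forall x, nth 0 rho x < word_bound l) ->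
     wp K l w p rho m T Q) -> wp K l w p rho m T Q.
Proof. by move=> H s R; have [_ _ _ Hx Ha] := R; apply: H. Qed.

Lemma size_clause_le c : size (nth [::] F c) <= 2 * N.
Proof.
have [lt_c|ge_c] := ltnP c (size F); last by rewrite nth_default.
have u : uniq (nth [::] F c) by apply: (allP wf_F); rewrite mem_nth.
rewrite -(card_uniqP u); apply: leq_trans (max_card _) _.
by rewrite card_prod card_ord card_bool mulnC.
Qed.

Definition clause_pos c := 2 + size (flatten (map (@encode_clause N) (take c F))).

Lemma clause_posS c : c < M ->
  clause_pos c.+1 = clause_pos c + (size (nth [::] F c)).+1.
Proof.
move=> lt_c; rewrite /clause_pos (take_nth [::]) ?size_F // map_rcons.
by rewrite flatten_rcons size_cat /= size_map addnA.
Qed.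

Lemma clause_pos_le c : c <= M -> clause_pos c <= 2 + c * (2 * N + 1).
Proof.
elim: c => [|c IH] lt_c; first by rewrite /clause_pos take0.
rewrite clause_posS //; have := IH (ltnW lt_c); have := size_clause_le c.
by rewrite mulSn; lia.
Qed.

Lemma clause_pos_lt c x : c < M -> x <= size (nth [::] F c) ->
  clause_pos c + x < mask_base N M.
Proof.
move=> lt_c le_x; have := clause_pos_le lt_c; rewrite clause_posS // /mask_base.
have : c.+1 * (2 * N + 1) <= M * (2 * N + 1) by rewrite leq_mul2r lt_c orbT.
by lia.
Qed.

Lemma nth_encode_cnf c x : c < M -> x <= size (nth [::] F c) ->
  nth 0 (encode_cnf F) (clause_pos c + x) = nth 0 (encode_clause (nth [::] F c)) x.
Proof.
move=> lt_c le_x; rewrite /encode_cnf /clause_pos add2n !addSn /=.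
rewrite -{1}(cat_take_drop c F) map_cat flatten_cat nth_cat.
rewrite ltnNge leq_addr /= addKn (drop_nth [::]) ?size_F //=.
by case: x le_x => // x lt_x; rewrite /= nth_cat size_map lt_x.
Qed.

Lemma mask_take_S b c j : j < size (nth [::] F c) ->
  let x := nth 0 (map (@encode_literal N) (nth [::] F c)) j in
  clause_mask b (take j.+1 (nth [::] F c)) =
    if x %% 2 == b then Nat.lor (clause_mask b (take j (nth [::] F c))) (Nat.shiftl 1 (x %/ 2))
    else clause_mask b (take j (nth [::] F c)).
Proof.
set cl := nth [::] F c => lt_j.
have [x0 _] : exists x0 : literal N, true by case: (cl) lt_j => // y; exists y.
rewrite (nth_map x0) // (take_nth x0) // /clause_mask foldl_rcons /mask_update.
set y := nth x0 cl j; rewrite /encode_literal.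
have -> : (2 * y.1 + y.2) %% 2 = y.2 by case: (y.2); lia.
have -> : (2 * y.1 + y.2) %/ 2 = y.1 by case: (y.2); lia.
by case: (y.2); case: b.
Qed.

(** The second part says that the cells of the tables and of the instance are still blank. *)
Definition has_masks (m : nat -> nat) : Prop :=
  (forall c (b : bool), c < M -> m (mask_base N M + (2 * c + b)) = clause_mask b (nth [::] F c))
  /\ (forall a, table_base N M <= a -> m a = 0).

Lemma wp_parse p c i j x rest :
  wp K l w (parse_prog K) (env [:: p, c, i, j, x & rest])
    (nth 0 (encode_cnf F)) (M * (100 * N + 40) + 10)
    (fun rho m => has_masks m /\
       exists p' c' i' j' x', rho = env [:: p', c', i', j', x' & rest]).
Proof.
have bnd := instance_fits lt_Nl lt_Ml.
have base_big : mask_base N M + 2 * M <= instance_base N M.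
  by rewrite /instance_base /table_base; lia.
pose Inv c' (m : nat -> nat) :=
  [/\ forall a, a < mask_base N M -> m a = nth 0 (encode_cnf F) a,
      forall d (b : bool), d < c' -> m (mask_base N M + (2 * d + b)) = clause_mask b (nth [::] F d)
    & forall a, mask_base N M + 2 * c' <= a -> m a = 0].
pose I c' (rho : seq nat) (m : nat -> nat) := Inv c' m /\
  exists i' j' x', rho = env [:: clause_pos c', c', i', j', x' & rest].
eapply wp_time.
  eapply wp_seq; apply: wp_assign => //=; first by lia.
  eapply (@wp_for K l w l_gt0 lw M I (fun _ => 2 * N * 48 + 20)) => //=.
  - by lia.
  - split; last by exists i, j, x; rewrite /clause_pos take0.
    split=> // a; rewrite muln0 addn0 => le_a; rewrite nth_default //.
    rewrite /encode_cnf /=; have := clause_pos_le (leqnn M).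
    by rewrite /clause_pos -{1}size_F take_size /mask_base; move: le_a; rewrite /mask_base; lia.
  - by move=> c' rho m [_ [i' [j' [x' ->]]]].
  - move=> c' rho m lt_c [[mem_in mem_done mem_0] [i' [j' [x' ->]]]].
    apply: wp_bounds => lt_m lt_rho.
    set cl := nth [::] F c'.
    have in_cl y : y <= size cl -> m (clause_pos c' + y) = nth 0 (encode_clause cl) y.
      by move=> le_y; rewrite mem_in ?clause_pos_lt // nth_encode_cnf.
    have sz_cl : m (clause_pos c') = size cl by rewrite -[clause_pos c']addn0 in_cl.
    have pos_lt y := @clause_pos_lt c' y lt_c.
    eapply wp_time.
    + eapply wp_seq; apply: wp_assign => //=.
      eapply wp_seq; apply: wp_assign => //=.
        by have := pos_lt 0 isT; lia.
      rewrite sz_cl.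
      (* [J] adds to the outer invariant that the two masks of clause [c'] account for its first
         [j''] literals. *)
      pose J j'' (rho : seq nat) (m' : nat -> nat) :=
        [/\ forall a, a < mask_base N M -> m' a = nth 0 (encode_cnf F) a,
          forall d (b : bool), d < c' ->
            m' (mask_base N M + (2 * d + b)) = clause_mask b (nth [::] F d),
          forall b : bool, m' (mask_base N M + (2 * c' + b)) = clause_mask b (take j'' cl),
          forall a, mask_base N M + (2 * c' + 2) <= a -> m' a = 0
        & exists x'', rho = env [:: clause_pos c' + 1 + j'', c', size cl, j'', x'' & rest]].
      eapply (@wp_for K l w l_gt0 lw (size cl) J (fun _ => 40)) => //=.
      * by have := pos_lt (size cl) (leqnn _); lia.
      * split=> //; last by exists x'; rewrite addn0.
        - by move=> b; rewrite take0 mem_0 //; lia.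
        - by move=> a le_a; rewrite mem_0 //; lia.
      * by move=> j'' rho' m' [_ _ _ _ [x'' ->]].
      * move=> j'' rho' m' lt_j [in' done' cur' z' [x'' ->]].
        apply: wp_bounds => lt_m' lt_rho'.
        set code := nth 0 (map (@encode_literal N) cl) j''.
        have code_E : m' (clause_pos c' + 1 + j'') = code.
          by rewrite -addnA add1n in' ?pos_lt // nth_encode_cnf //=.
        have code_lt : code < 2 * N.
          rewrite /code.
          have : nth 0 (map (@encode_literal N) cl) j'' \in map (@encode_literal N) cl.
            by rewrite mem_nth ?size_map.
          case/mapP=> -[y b] _ ->; rewrite /encode_literal /=; have := ltn_ord y.
          by case: b; lia.
        have par_lt : code %% 2 < 2 by rewrite ltn_mod.
        eapply wp_time.
        + eapply wp_seq; apply: wp_assign => //=.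
          eapply wp_seq; apply: wp_store => //=.
          * by rewrite code_E; do !split=> //; lia.
          * rewrite code_E; apply: lor_lt; first exact: lt_m'.
            by rewrite shiftlE mul1n ltn_exp2l //; lia.
          rewrite code_E; apply: wp_assign => //=.
            by have := pos_lt j''.+1 lt_j; lia.
          split=> //; split.
          * by move=> a lt_a; rewrite upd_other ?in' //; lia.
          * by move=> d b lt_d; rewrite upd_other ?done' //; case: b; lia.
          * move=> b; rewrite mask_take_S // -/cl -/code /upd !eqn_add2l eq_sym.
            rewrite cur'; case: eqP => // ->.
            by rewrite cur'.
          * by move=> a le_a; rewrite upd_other ?z' //; lia.
          * by exists code; rewrite addn1 !addnS.
        + by rewrite /=.
      * move=> rho' m' [in' done' cur' z' [x'' ->]]; split=> //; split.
        - split=> //.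
          + move=> d b; rewrite ltnS leq_eqVlt => /orP[/eqP->|]; last exact: done'.
            by rewrite cur' take_size.
          + by move=> a le_a; apply: z'; lia.
        - by exists (size cl), (size cl), x''; rewrite clause_posS // addn1 addSnnS.
    + rewrite /= sum_nat_const_nat subn0; have := size_clause_le c'; rewrite -/cl.
      by lia.
  - move=> rho m [[_ done z] [i' [j' [x' ->]]]]; split.
      by split=> // a; apply: z.
    by exists (clause_pos M), M, i', j', x'.
by rewrite /= sum_nat_const_nat subn0; lia.
Qed.

End Reduction.

(** * Satisfaction tables of the half assignments *)

Lemma testbit_shiftl1 x i : Nat.testbit (Nat.shiftl 1 x) i = (x == i).
Proof.
rewrite PeanoNat.Nat.shiftl_1_l PeanoNat.Nat.pow2_bits_eqb.
by case: (PeanoNat.Nat.eqb_spec x i) => [->|/eqP/negbTE->]; rewrite ?eqxx.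
Qed.

Lemma testbit_mask N (b : bool) (c : clause N) i :
  Nat.testbit (clause_mask b c) i = has (fun x : literal N => (x.2 == b) && (x.1 == i :> nat)) c.
Proof.
rewrite /clause_mask -[RHS]orFb -(PeanoNat.Nat.bits_0 i).
elim: c (0) => [|x c IH] acc /=; first by rewrite orbF.
rewrite IH /mask_update orbA; congr (_ || _).
by case: (x.2 == b); rewrite /= ?orbF // PeanoNat.Nat.lor_spec testbit_shiftl1.
Qed.

Lemma testbit_shiftl a n i :
  Nat.testbit (Nat.shiftl a n) i = (n <= i) && Nat.testbit a (i - n).
Proof.
have [le_ni|lt_in] := leqP n i; last exact/PeanoNat.Nat.shiftl_spec_low/ssrnat.ltP.
apply: PeanoNat.Nat.shiftl_spec_high'; exact/ssrnat.leP.
Qed.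

Lemma testbit_ones n i : Nat.testbit (2 ^ n - 1) i = (i < n).
Proof.
have -> : 2 ^ n - 1 = PeanoNat.Nat.ones n.
  by rewrite PeanoNat.Nat.ones_equiv powE subn1.
have [lt_in|le_ni] := ltnP i n.
  exact/PeanoNat.Nat.ones_spec_low/ssrnat.ltP.
exact/PeanoNat.Nat.ones_spec_high/ssrnat.leP.
Qed.

(** The shift aligns the bits of [a] with the variables of side [s]. The first operand collects the
    satisfied positive literals, the second, with [a] complemented within the half, the satisfied
    negative ones. *)
Lemma half_sat_clause_mask N s a (c : clause N) : a < 2 ^ half_vars N ->
  (0 < Nat.lor (Nat.land (clause_mask true c) (Nat.shiftl a (s * half_vars N)))
     (Nat.land (clause_mask false c)
        (Nat.shiftl (Nat.lxor a (2 ^ half_vars N - 1)) (s * half_vars N))))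
  = half_sat_clause s a c.
Proof.
move=> lt_a; set h := half_vars N; set x := Nat.lor _ _.
have bits_a i : h <= i -> Nat.testbit a i = false by move: i; apply/ltn_pow2_bits.
have bit i : Nat.testbit x i = has (fun y : literal N => (y.1 == i :> nat) &&
    ((s * h <= i < s * h + h) && (Nat.testbit a (i - s * h) == y.2))) c.
  rewrite PeanoNat.Nat.lor_spec !PeanoNat.Nat.land_spec !testbit_mask !testbit_shiftl.
  rewrite PeanoNat.Nat.lxor_spec testbit_ones.
  have [le_i|lt_i] /= := leqP (s * h) i; last first.
    rewrite !andbF; apply/esym/hasP => -[y _]; rewrite !andbF //.
  have -> : (i - s * h < h) = (i < s * h + h) by lia.
  have [lt_i|ge_i] := ltnP i (s * h + h); last first.
    rewrite bits_a; last by lia.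
    by rewrite /= !andbF; apply/esym/hasP => -[y _]; rewrite !andbF.
  have -> : xorb (Nat.testbit a (i - s * h)) true = ~~ Nat.testbit a (i - s * h).
    by case: Nat.testbit.
  case: (Nat.testbit a (i - s * h)); rewrite /= ?andbT ?andbF ?orbF ?orFb.
  + by apply: eq_has => -[y [|]]; rewrite /= ?andbT ?andbF.
  + by apply: eq_has => -[y [|]]; rewrite /= ?andbT ?andbF.
apply/idP/idP => [x_gt0|].
  have [i] : exists i, Nat.testbit x i by apply: neq0_testbit; lia.
  rewrite bit => /hasP[y cy /andP[/eqP <- sat]].
  by apply/hasP; exists y.
case/hasP=> y cy sat.
have : Nat.testbit x y.1 by rewrite bit; apply/hasP; exists y => //; rewrite eqxx.
by case: (x) => //; rewrite PeanoNat.Nat.bits_0.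
Qed.

Definition sat_expr : expr :=
  (Cst 0 < Bin OpOr
    (Bin OpAnd (Fetch (Var 3 + (Cst 2 * Var 11 + Cst 1)))
       (Bin OpShl (Var 12) (Var 15 * Var 2)))
    (Bin OpAnd (Fetch (Var 3 + (Cst 2 * Var 11 + Cst 0)))
       (Bin OpShl (Bin OpXor (Var 12) (Var 8 - Cst 1)) (Var 15 * Var 2))))%expr.

Definition table_addr (i c : expr) : expr :=
  (Var 6 + ((Var 15 * Var 5 + i) * Var 1 + c))%expr.

(** Variable 15 is the side, 12 the half assignment and 16 its row index; the first conditional is
    the case distinction of [row_index]. Cells are only ever set to 1, so half assignments that
    share a row accumulate in it. *)
Definition table_prog K : cmd :=
  for_ K 15 (Cst 2) (for_ K 12 (Var 8) (
    Seq (assign K 16 (Var 12)) (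
    Seq (cond K (Var 1 < Var 2)%expr
          (Seq (assign K 16 (Cst 0))
               (for_ K 11 (Var 1) (assign K 16 (Cst 2 * Var 16 + sat_expr)%expr)))
          Skip)
        (for_ K 11 (Var 1)
          (cond K sat_expr (store K (table_addr (Var 16) (Var 11)) (Cst 1)) Skip))))).

Section Tables.
Variables N M : nat.
Let H := 2 ^ log_rows N M.

Definition table_cell s i c := table_base N M + ((s * H + i) * M + c).

Lemma table_cell_inj s i c s' i' c' : i < H -> i' < H -> c < M -> c' < M ->
  table_cell s i c = table_cell s' i' c' -> [/\ s = s', i = i' & c = c'].
Proof.
move=> lt_i lt_i' lt_c lt_c' /addnI e.
have [e1 e2] : s * H + i = s' * H + i' /\ c = c'.
  split; [have := congr1 (divn^~ M) e|have := congr1 (modn^~ M) e] => /=.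
    by rewrite !divnMDl; [|lia|lia]; rewrite !divn_small ?addn0.
  by rewrite !modnMDl !modn_small.
split=> //; [have := congr1 (divn^~ H) e1|have := congr1 (modn^~ H) e1] => /=.
  by rewrite !divnMDl ?expn_gt0 // !divn_small ?addn0.
by rewrite !modnMDl !modn_small.
Qed.

Lemma table_cell_lt s i c : s < 2 -> i < H -> c < M ->
  table_cell s i c < instance_base N M.
Proof.
move=> lt_s lt_i lt_c; rewrite /table_cell /instance_base ltn_add2l -/H.
apply: (@leq_trans ((s * H + i).+1 * M)); first by rewrite mulSnr ltn_add2l.
by rewrite mulnA leq_mul2r; case: s lt_s => [|[|]] // _; lia.
Qed.

Variables (K l w : nat) (F : cnf N).
Hypotheses (lw : l * 64 <= w) (lt_Nl : N < l) (lt_Ml : M < 2 ^ l).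

Notation env locals := [:: N, M, half_vars N, mask_base N M, log_rows N M,
  2 ^ log_rows N M, table_base N M, instance_base N M, 2 ^ half_vars N,
  alphabet N M & locals].

Let l_gt0 : 0 < l. Proof. lia. Qed.
Lemma eval_sat_expr m p c a j x s rest : (forall d (b : bool), d < M ->
    m (mask_base N M + (2 * d + b)) = clause_mask b (nth [::] F d)) ->
  c < M -> a < 2 ^ half_vars N -> s < 2 ->
  eval_expr sat_expr (env [:: p, c, a, j, x, s & rest]) m = half_sat F s a c.
Proof.
move=> masks lt_c lt_a lt_s; rewrite /sat_expr /=.
have -> : mask_base N M + (2 * c + 1) = mask_base N M + (2 * c + true) by [].
have -> : mask_base N M + (2 * c + 0) = mask_base N M + (2 * c + false) by [].
by rewrite !masks // half_sat_clause_mask.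
Qed.

Lemma small_shifts_sat_expr m p c a j x s rest : s < 2 ->
  small_shifts l sat_expr (env [:: p, c, a, j, x, s & rest]) m.
Proof.
move=> lt_s /=; have := half_vars_le N.
have : s * half_vars N <= half_vars N by case: s lt_s => [|[|]]; lia.
by move=> *; do !split=> //; lia.
Qed.

Definition partial_table n s i c : bool :=
  has (fun a => (row_index M F s a == i) && half_sat F s a c) (iota 0 n).

Definition has_tables (m : nat -> nat) : Prop :=
  (forall s i c, s < 2 -> i < H -> c < M ->
     m (table_cell s i c) = row_table M F s i c)
  /\ (forall a, instance_base N M <= a -> m a = 0).

Lemma wp_table p c i j x s f rest m0 : has_masks M F m0 ->
  wp K l w (table_prog K) (env [:: p, c, i, j, x, s, f & rest]) m0
    (2 ^ half_vars N * (M * 1000 + 1000))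
    (fun rho m => has_tables m /\
      exists c' i' s' f', rho = env [:: p, c', i', j, x, s', f' & rest]).
Proof.
case=> masks0 zero0.
have bnd : _ < word_bound l := instance_fits lt_Nl lt_Ml.
have base_big : mask_base N M + 2 * M <= instance_base N M.
  by rewrite /instance_base /table_base; lia.
have h_big : 2 ^ half_vars N < word_bound l by lia.
have M_big : M < word_bound l by lia.
(* The number of half assignments of side [s'] already entered when the loops reach assignment [a]
   of side [s]. *)
pose count_s s a s' := if s' < s then 2 ^ half_vars N else if s' == s then a else 0.
pose Inv s a (m : nat -> nat) := [/\
  forall b, b < table_base N M -> m b = m0 b,
  forall s' i c, s' < 2 -> i < H -> c < M ->
    m (table_cell s' i c) = partial_table (count_s s a s') s' i c
  & forall b, instance_base N M <= b -> m b = 0].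
pose I s (rho : seq nat) m := Inv s 0 m /\
  exists c' i' f', rho = env [:: p, c', i', j, x, s, f' & rest].
pose J s a (rho : seq nat) m := Inv s a m /\
  exists c' f', rho = env [:: p, c', a, j, x, s, f' & rest].
eapply wp_time.
  eapply (@wp_for K l w l_gt0 lw 2 I
    (fun _ => 2 ^ half_vars N * (M * 400 + 400) + 6)) => //=.
  - by apply: leq_ltn_trans bnd; rewrite -addnA addnC; lia.
  - split; last by exists c, i, f.
    split=> // [s' i' c' lt_s' lt_i' lt_c'|b le_b].
      rewrite zero0 /table_cell ?leq_addr //.
      by rewrite /count_s ltn0; case: (s' == 0).
    by apply: zero0; apply: leq_trans le_b; rewrite /instance_base leq_addr.
  - by move=> s' rho m [_ [c' [i' [f' ->]]]].
  - move=> s' rho m lt_s' [inv [c' [i' [f' ->]]]].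
    eapply wp_time.
      eapply (@wp_for K l w l_gt0 lw (2 ^ half_vars N) (J s')
        (fun _ => M * 400 + 380)) => //=.
      + by split=> //; exists c', f'.
      + by move=> a rho' m' [_ [c'' [f'' ->]]].
      + move=> a rho' m' lt_a [[low tab zero] [c'' [f'' ->]]].
        have masks d (b : bool) : d < M ->
            m' (mask_base N M + (2 * d + b)) = clause_mask b (nth [::] F d).
          by move=> lt_d; rewrite low ?masks0 // /table_base; case: b; lia.
        set ix := row_index M F s' a.
        have lt_ix : ix < H by apply: row_index_lt.
        have le_HP : H <= 2 ^ half_vars N by rewrite leq_exp2l // log_rows_le.
        eapply wp_time.
          eapply wp_seq; apply: wp_assign => //=; first by lia.
          eapply wp_seq.
          (* Whichever branch is taken, variable 16 ends up holding the row index [ix]; only the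
             loop variable 11 is left unspecified. *)
          have post1 (P1 : seq nat -> (nat -> nat) -> Prop) :
              (forall c1, P1 (env [:: p, c1, a, j, x, s', ix & rest]) m') ->
              wp K l w (cond K (Var 1 < Var 2)%expr
                (Seq (assign K 16 (Cst 0))
                 (for_ K 11 (Var 1) (assign K 16 (Cst 2 * Var 16 + sat_expr)%expr)))
                Skip) (env [:: p, c'', a, j, x, s', a & rest]) m' (M * 100 + 100) P1.
            move=> HP1; eapply wp_time.
              apply: (@wp_cond K l w l_gt0 lw _ _ _ _ _ (M * 100 + 80)) => //=.
                rewrite /ix /row_index; case: (ltnP M (half_vars N)) => // lt_M _.
                eapply wp_time.
                  eapply wp_seq; apply: wp_assign => //=; first by lia.
                  eapply (@wp_for K l w l_gt0 lw M (fun c1 rho1 m1 =>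
                    m1 = m' /\ rho1 = env [:: p, c1, a, j, x, s', row_code F s' a c1 & rest])
                    (fun _ => 80)) => //=.
                  - by move=> c1 rho1 m1 [_ ->].
                  - move=> c1 rho1 m1 lt_c1 [-> ->].
                    have lt_code := row_code_lt F s' a c1.+1.
                    have le_code : 2 ^ c1.+1 <= 2 ^ half_vars N by rewrite leq_exp2l //; lia.
                    have E := @eval_sat_expr m' p c1 a j x s' [:: row_code F s' a c1 & rest]
                       masks lt_c1 lt_a lt_s'.
                    have E' : eval_expr (Cst 2 * Var 16 + sat_expr)%expr
                        (env [:: p, c1, a, j, x, s', row_code F s' a c1 & rest]) m' =
                        row_code F s' a c1.+1 by rewrite row_codeS -E.
                    apply: (wp_time (T := cost (Cst 2 * Var 16 + sat_expr)%expr + 1)) => //.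
                    apply: wp_assign => //.
                    + split; first by [].
                      exact: small_shifts_sat_expr.
                    + by rewrite E'; lia.
                    + by rewrite E'.
                  - move=> rho1 m1 [-> ->]; have := HP1 M.
                    by rewrite /ix /row_index lt_M.
                by rewrite /= sum_nat_const_nat subn0; lia.
              rewrite -/ix; move=> e0; apply: (wp_time (T := 0)) => //; apply: wp_skip.
              have := HP1 c''; rewrite /ix /row_index; case: (ltnP M (half_vars N)) e0 => //.
            by rewrite /=; lia.
          apply: post1 => c1.
          (* The invariant: the table of the assignments before [a], together with the clauses
             before [c2] in the row of [a]. *)
          eapply (@wp_for K l w l_gt0 lw M (fun c2 rho1 m1 => [/\
             forall b, b < table_base N M -> m1 b = m0 b,
             forall s1 i1 c1, s1 < 2 -> i1 < H -> c1 < M -> m1 (table_cell s1 i1 c1) =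
               partial_table (count_s s' a s1) s1 i1 c1
               || [&& s1 == s', i1 == ix, c1 < c2 & half_sat F s' a c1],
             forall b, instance_base N M <= b -> m1 b = 0
             & rho1 = env [:: p, c2, a, j, x, s', ix & rest]])
             (fun _ => 150)) => //=.
          - split=> // s1 i1 d lt_s1 lt_i1 lt_d; rewrite tab //.
            by rewrite /= ?ltn0 !andbF orbF.
          - by move=> c2 rho1 m1 [_ _ _ ->].
          - move=> c2 rho1 m1 lt_c2 [low1 tab1 zero1 ->].
            have masks1 d (b : bool) : d < M ->
                m1 (mask_base N M + (2 * d + b)) = clause_mask b (nth [::] F d).
              by move=> lt_d; rewrite low1 ?masks0 // /table_base; case: b; lia.
            have E := @eval_sat_expr m1 p c2 a j x s' [:: ix & rest]
               masks1 lt_c2 lt_a lt_s'.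
            have tab_next s1 i1 d : s1 < 2 -> i1 < H -> d < M ->
                (s1, i1, d) <> (s', ix, c2) ->
                m1 (table_cell s1 i1 d) = partial_table (count_s s' a s1) s1 i1 d
                 || [&& s1 == s', i1 == ix, d < c2.+1 & half_sat F s' a d].
              move=> lt_s1 lt_i1 lt_d ne; rewrite tab1 // [d < c2.+1]ltnS [d <= c2]leq_eqVlt.
              case: (eqVneq s1 s') => //= es; case: (eqVneq i1 ix) => //= ei.
              case: (eqVneq d c2) => //= ed.
              by case: ne; rewrite es ei ed.
            eapply wp_time.
              apply: (@wp_cond K l w l_gt0 lw _ _ _ _ _ 20) => //.
              + exact: small_shifts_sat_expr.
              + rewrite E => sat.
                have {}sat : half_sat F s' a c2 by case: half_sat sat.
                apply: (wp_time (T := 13)) => //.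
                apply: (@wp_store K l w l_gt0 lw (table_addr (Var 16) (Var 11)) (Cst 1)) => //=.
                  by lia.
                rewrite -/H -/(table_cell s' ix c2); split=> //; split=> //.
                * move=> b lt_b; rewrite upd_other ?low1 //.
                  by rewrite /table_cell; lia.
                * move=> s1 i1 d lt_s1 lt_i1 lt_d; rewrite /upd; case: eqP => [e|ne].
                    have [-> -> ->] := table_cell_inj lt_i1 lt_ix lt_d lt_c2 e.
                    by rewrite !eqxx ltnSn sat orbT.
                  by apply: tab_next => // -[e1 e2 e3]; case: ne; rewrite e1 e2 e3.
                * move=> b le_b; rewrite upd_other ?zero1 //.
                  by have := table_cell_lt lt_s' lt_ix lt_c2; lia.
              + rewrite E => sat; apply: (wp_time (T := 0)) => //; apply: wp_skip.
                have {}sat : half_sat F s' a c2 = false by case: half_sat sat.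
                split=> //; split=> // s1 i1 d lt_s1 lt_i1 lt_d.
                have [[-> -> ->]|ne] := EM ((s1, i1, d) = (s', ix, c2)); last exact: tab_next.
                by rewrite tab1 // ltnn sat !andbF.
            by [].
          - move=> rho1 m1 [low1 tab1 zero1 ->]; split=> //; split.
              split=> // s1 i1 d lt_s1 lt_i1 lt_d; rewrite tab1 // lt_d /=.
              rewrite /count_s; case: (ltngtP s1 s') => // [|es]; rewrite /= ?orbF //.
              rewrite /partial_table -[a.+1]addn1 iotaD has_cat /= orbF es /ix.
              by rewrite [i1 == _]eq_sym.
            by exists M, ix.
        by rewrite /= sum_nat_const_nat subn0; lia.
      + move=> rho' m' [[low tab zero] [c'' [f'' ->]]]; split=> //; split.
          split=> // s1 i1 d lt_s1 lt_i1 lt_d; rewrite tab // /count_s ltnS.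
          by case: (ltngtP s1 s') => // lt; case: eqP.
        by exists c'', (2 ^ half_vars N), f''.
    by rewrite /= sum_nat_const_nat subn0; lia.
  - move=> rho m [[low tab zero] [c' [i' [f' ->]]]]; split.
      split=> // s1 i1 d lt_s1 lt_i1 lt_d; rewrite tab //.
      by rewrite /count_s lt_s1.
    by exists c', i', 2, f'.
rewrite /= sum_nat_const_nat subn0.
have : 0 < 2 ^ half_vars N by rewrite expn_gt0.
move: (2 ^ half_vars N) => P P_gt0.
have : M * 400 + 400 <= P * (M * 400 + 400) by rewrite leq_pmull.
by rewrite !mulnDr !mulnA; lia.
Qed.

End Tables.

(** * Writing the LCWIS instance *)

Definition run_weight : expr := (Cst 6 * Var 1 * (1<< (Var 19)))%expr.

(** Variable 16 is the flipped symbol, 17 and 18 are symbol and block, mirrored for large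
    separators, 19 is the exponent [r] or the table entry [t], and 20 receives the multiplicity. In
    the middle part [clause_runs] is [2 * t] or [3 - 2 * t]. *)
Definition mult_prog K : cmd :=
  Seq (assign K 16 (Var 11 + Var 15 - Cst 2 * (Var 15 * (Var 11 %% Cst 2)))%expr) (
  Seq (assign K 17 (Var 16)) (
  Seq (assign K 18 (Var 12)) (
  Seq (cond K (Var 16 < Cst 2 * Var 4 + Cst 2 * Var 1)%expr Skip
        (Seq (assign K 17 (Var 9 - Cst 1 - Var 16)%expr)
             (assign K 18 (Var 5 - Cst 1 - Var 12)%expr)))
      (cond K (Var 17 < Cst 2 * Var 4)%expr
        (Seq (assign K 19 (Var 4 - Cst 1 - Var 17 %/ Cst 2)%expr)
          (cond K (Var 17 %% Cst 2)%expr
            (assign K 20 (run_weight * (Var 18 %% (1<< (Var 19)) == Cst 0))%expr)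
            (assign K 20
              (run_weight * (Var 18 %% (1<< (Var 19 + Cst 1)) == (1<< (Var 19))))%expr)))
        (Seq (assign K 19 (Fetch (table_addr (Var 12)
                ((Var 16 - Cst 2 * Var 4) %/ Cst 2)%expr)))
          (cond K (Var 16 %% Cst 2)%expr
            (assign K 20 (Cst 2 * Var 19)%expr)
            (assign K 20 (Cst 3 - Cst 2 * Var 19)%expr))))))).

(** The sequences are written one after the other, leaving the first cell free; it finally receives
    their common length, which is half of what was written. *)
Definition emit_prog K : cmd :=
  Seq (assign K 10 (Var 7 + Cst 1)%expr) (
  Seq (for_ K 15 (Cst 2) (for_ K 12 (Var 5) (for_ K 11 (Var 9) (
         Seq (mult_prog K) (
         loop K (Var 20) (
           Seq (store K (Var 10) (Var 11)) (
           Seq (assign K 10 (Var 10 + Cst 1)%expr)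
               (assign K 20 (Var 20 - Cst 1)%expr))))))))
      (store K (Var 7) ((Var 10 - Var 7 - Cst 1) %/ Cst 2)%expr)).

Section Emit.
Variables (N M : nat) (F : cnf N).

Notation env locals := [:: N, M, half_vars N, mask_base N M, log_rows N M,
  2 ^ log_rows N M, table_base N M, instance_base N M, 2 ^ half_vars N,
  alphabet N M & locals].

Let k := log_rows N M.
Let H := 2 ^ k.
Let V := alphabet N M.
Let base := instance_base N M.

Definition side s := lcwis_side s k M (row_table M F s).

Lemma log_rows_le_clauses : k <= M. Proof. exact: geq_minr. Qed.

Lemma alphabet_le : V <= 6 * M.
Proof. rewrite /V /alphabet -/k; have := log_rows_le_clauses; lia. Qed.

Lemma weight_le r : r <= k -> 6 * M * 2 ^ r + 6 * M + 6 <= 72 * M.+1 ^ 2 * H.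
Proof.
move=> le_r; have le_H : 2 ^ r <= H by rewrite leq_exp2l.
have H_gt0 : 0 < H by rewrite expn_gt0.
have -> : 72 * M.+1 ^ 2 * H = (36 * M.+1 ^ 2) * H + (36 * M.+1 ^ 2) * H.
  by rewrite -mulnDl; congr (_ * _); lia.
have : 6 * M * 2 ^ r <= (36 * M.+1 ^ 2) * H by apply: leq_mul => //; lia.
have : 36 * M.+1 ^ 2 <= 36 * M.+1 ^ 2 * H by rewrite leq_pmulr.
by lia.
Qed.

Definition sides n : seq nat := flatten [seq side s | s <- iota 0 n].

(** What has been written once [e] copies of symbol [v] in block [i] of side [s] are out. *)
Definition partial_output s i v e : seq nat :=
  sides s ++ (block_word i V (fun i v => mult k M (row_table M F s) i (flip s v)) ++
    (block v (fun v => mult k M (row_table M F s) i (flip s v)) ++ nseq e v)).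

Lemma size_side_le s : s < 2 -> size (side s) <= 36 * M.+1 ^ 2 * H.
Proof. by move=> lt_s; apply: size_lcwis_side_le => //; apply: log_rows_le_clauses. Qed.

Lemma size_sides_le : size (sides 2) <= 72 * M.+1 ^ 2 * H.
Proof.
rewrite /sides /= cats0 size_cat.
have := @size_side_le 0 isT; have := @size_side_le 1 isT.
move: (M.+1 ^ 2 * H) (mulnA 36 (M.+1 ^ 2) H) (mulnA 72 (M.+1 ^ 2) H) => z <- <-; lia.
Qed.

Lemma size_partial_output s i v e : s < 2 -> i < H -> v < V ->
  e <= mult k M (row_table M F s) i (flip s v) ->
  size (partial_output s i v e) <= 72 * M.+1 ^ 2 * H.
Proof.
move=> lt_s lt_i lt_v le_e; apply: leq_trans size_sides_le.
apply: size_subseq; apply: (@subseq_trans _ (sides s ++ side s)).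
  apply: cat_subseq => //; rewrite /side /lcwis_side.
  apply: subseq_trans (subseq_block_word _ _ (lt_i : i.+1 <= 2 ^ k)).
  rewrite block_wordS; apply: cat_subseq => //.
  apply: subseq_trans (subseq_block_prefix _ lt_v).
  by rewrite blockS; apply: cat_subseq => //; apply: subseq_nseq.
rewrite -flatten_iotaS -/(sides s.+1).
case: s lt_s {le_e} => [|[|]] // _; rewrite /sides /= ?cats0 //.
exact: prefix_subseq.
Qed.

Definition emitted (m0 : nat -> nat) (out : seq nat) (m : nat -> nat) : Prop :=
  (forall a, a < base -> m a = m0 a) /\ forall z, m (base + 1 + z) = nth 0 out z.

Lemma emitted_rcons m0 out m v : emitted m0 out m ->
  emitted m0 (rcons out v) (upd m (base + 1 + size out) v).
Proof.
case=> low high; split=> [a lt_a|z]; first by rewrite upd_other ?low //; lia.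
rewrite /upd nth_rcons eqn_add2l high; case: ltngtP => // gt.
by rewrite nth_default // ltnW.
Qed.

Definition has_instance (m : nat -> nat) : Prop :=
  forall z, m (base + z) = nth 0 (encode_LCWIS (side 0) (side 1)) z.

Variables K l w : nat.
Hypotheses (lt_Nl : N < l) (lt_Ml : M < 2 ^ l).

Lemma side_fits : base + 72 * M.+1 ^ 2 * H + 4 < word_bound l.
Proof. by have := instance_fits lt_Nl lt_Ml; rewrite -/k -/H -/base; lia. Qed.

Hypothesis lw : l * 64 <= w.
Let l_gt0 : 0 < l. Proof. lia. Qed.

Lemma wp_mult p v i j x s f g y r n rest (m : nat -> nat)
    (Q : seq nat -> (nat -> nat) -> Prop) :
  (forall c, c < M -> m (table_cell N M s i c) = row_table M F s i c) ->
  s < 2 -> i < H -> v < V ->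
  (forall f' g' y' r', Q (env [:: p, v, i, j, x, s, f', g', y', r',
     mult k M (row_table M F s) i (flip s v) & rest]) m) ->
  wp K l w (mult_prog K) (env [:: p, v, i, j, x, s, f, g, y, r, n & rest]) m 200 Q.
Proof.
move=> tab lt_s lt_i lt_v HQ.
have big := side_fits; have leV := alphabet_le; have lekM := log_rows_le_clauses.
have big6 := weight_le (leqnn k).
have lt_kl : k < l by have := log_rows_le N M; have := half_vars_le N; rewrite -/k; lia.
have HM : H <= 72 * M.+1 ^ 2 * H.
  by rewrite leq_pmull // muln_gt0 expn_gt0.
set fv := flip s v.
have lt_fv : fv < V.
  by move: lt_v; rewrite /fv /flip /V /alphabet; case: s lt_s {tab HQ fv} => [|[|]] // _; lia.
eapply wp_time.
  eapply wp_seq; apply: wp_assign => //=; rewrite -/(flip s v) -/fv.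
    by lia.
  eapply wp_seq; apply: wp_assign => //=; first by lia.
  eapply wp_seq; apply: wp_assign => //=; first by lia.
  eapply wp_seq.
  pose g' := if fv < 2 * k + 2 * M then fv else V - 1 - fv.
  pose y' := if fv < 2 * k + 2 * M then i else H - 1 - i.
  apply: (wp_weaken (T := 30) (Q := fun rho m' => m' = m /\
    rho = env [:: p, v, i, j, x, s, fv, g', y', r, n & rest])).
  - eapply wp_time.
      apply: (@wp_cond K l w l_gt0 lw _ _ _ _ _ 20) => //=; rewrite -/k /g' /y'.
        case: ltnP => // lt _; apply: (wp_time (T := 0)) => //; exact: wp_skip.
      case: ltnP => // ge _; eapply wp_time.
        eapply wp_seq; apply: wp_assign => //=; first by rewrite -/V; lia.
        by apply: wp_assign => //=; rewrite -/k -/H; lia.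
      by [].
    by [].
  - exact: leqnn.
  move=> rho m' [-> ->] {rho m'}.
  have lt_g : g' < V by rewrite /g'; case: ifP; lia.
  have lt_y : y' < H by rewrite /y'; case: ifP; lia.
  apply: (@wp_cond K l w l_gt0 lw _ _ _ _ _ 80) => //=; rewrite -/k.
  - case: (ltnP g' (2 * k)) => // lt_gk _.
    set r' := k - 1 - g' %/ 2; have le_r : r' <= k by rewrite /r'; lia.
    have wle := weight_le le_r.
    have Em : mult k M (row_table M F s) i fv = sep (6 * M) k y' g'.
      rewrite /mult /y'; move: lt_gk; rewrite /g'.
      case: (ltnP fv (2 * k + 2 * M)) => [lt1 lt2|ge1 _]; first by rewrite lt2.
      by rewrite ifF //; lia.
    eapply wp_time.
      eapply wp_seq; apply: wp_assign => //=; rewrite -/k -/r'.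
        by lia.
      apply: (@wp_cond K l w l_gt0 lw _ _ _ _ _ 60) => //=.
      + move=> odd_g; eapply wp_time.
          apply: wp_assign => //=.
          * by do !split=> //; lia.
          * rewrite !shiftlE !mul1n.
            apply: (@leq_ltn_trans (6 * M * 2 ^ r')); last by lia.
            by rewrite -[leqRHS]muln1 leq_mul2l leq_b1 orbT.
          * have := HQ fv g' y' r'; rewrite Em /sep ifF; last by lia.
            by rewrite -subn1 -/r' !shiftlE !mul1n.
        by [].
      + move=> even_g; eapply wp_time.
          apply: wp_assign => //=.
          * by do !split=> //; lia.
          * rewrite !shiftlE !mul1n.
            apply: (@leq_ltn_trans (6 * M * 2 ^ r')); last by lia.
            by rewrite -[leqRHS]muln1 leq_mul2l leq_b1 orbT.
          * have := HQ fv g' y' r'; rewrite Em /sep even_g /=.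
            by rewrite -subn1 -/r' !shiftlE !mul1n addn1.
        by [].
    by [].
  - case: (ltnP g' (2 * k)) => // ge_gk _.
    have lt_f : fv < 2 * k + 2 * M.
      by move: ge_gk lt_fv; rewrite /g' /V /alphabet -/k; case: ifP => //; lia.
    have ge_f : 2 * k <= fv by move: ge_gk; rewrite /g' lt_f.
    set c := (fv - 2 * k) %/ 2.
    have Et : m (table_base N M + ((s * 2 ^ k + i) * M + c)) = row_table M F s i c.
      by rewrite -tab //; rewrite /c; lia.
    have Em : mult k M (row_table M F s) i fv = clause_runs (row_table M F s i) (fv - 2 * k).
      by rewrite /mult ifF ?lt_f //; lia.
    have parE : (fv - 2 * k) %% 2 = fv %% 2 by lia.
    eapply wp_time.
      eapply wp_seq; apply: wp_assign => //=; rewrite -/k -/c Et.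
        by case: row_table; lia.
      apply: (@wp_cond K l w l_gt0 lw _ _ _ _ _ 20) => //=.
      + move=> odd_f; eapply wp_time.
          apply: wp_assign => //=; first by case: row_table; lia.
          have := HQ fv g' y' (row_table M F s i c); rewrite Em /clause_runs ifF; last by lia.
          by rewrite -/c; case: row_table.
        by [].
      + move=> even_f; eapply wp_time.
          apply: wp_assign => //=; first by case: row_table; lia.
          have := HQ fv g' y' (row_table M F s i c); rewrite Em /clause_runs ifT; last by lia.
          by rewrite -/c; case: row_table.
        by [].
    by [].
by [].
Qed.

(** A written copy costs 13 steps and each symbol of each block 210 more, so the time follows from
    [size_side_le] and [alphabet_le]. *)
Lemma wp_emit p c i j x s f g y r n rest m0 : has_tables M F m0 ->
  wp K l w (emit_prog K) (env [:: p, c, i, j, x, s, f, g, y, r, n & rest]) m0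
    (4000 * (M.+1 ^ 2 * H) + 4000)
    (fun rho m => has_instance m /\ exists rest', rho = env rest').
Proof.
case=> tab zero.
have big := side_fits; have leV := alphabet_le; have big6 := weight_le (leqnn k).
pose out s i v e := partial_output s i v e.
pose I s rho m := emitted m0 (sides s) m /\
  exists c i f g y r n, rho = env [:: base + 1 + size (sides s),
    c, i, j, x, s, f, g, y, r, n & rest].
pose J s i rho m := emitted m0 (sides s ++
    block_word i V (fun i v => mult k M (row_table M F s) i (flip s v))) m /\
  exists c f g y r n, rho = env [:: base + 1 + size (sides s ++
    block_word i V (fun i v => mult k M (row_table M F s) i (flip s v))),
      c, i, j, x, s, f, g, y, r, n & rest].
pose L s i v rho m := emitted m0 (partial_output s i v 0) m /\
  exists f g y r n, rho = env [:: base + 1 + size (partial_output s i v 0),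
      v, i, j, x, s, f, g, y, r, n & rest].
pose mu s i v := mult k M (row_table M F s) i (flip s v).
have H_big : H < word_bound l.
  apply: leq_ltn_trans big; rewrite -addnA -addnCA.
  by apply: leq_trans (leq_addr _ _); rewrite leq_pmull // muln_gt0 expn_gt0.
eapply wp_time.
  eapply wp_seq; apply: wp_assign => //=; first by rewrite -/base; lia.
  rewrite -/base; eapply wp_seq.
  eapply (@wp_for K l w l_gt0 lw 2 I
    (fun _ => 13 * (36 * (M.+1 ^ 2 * H)) + H * (V * 210) + H * 14 + 6)) => //=.
  - by lia.
  - split; last by exists c, i, f, g, y, r, n; rewrite addn0.
    split=> // z; rewrite nth_nil zero // -/base; lia.
  - by move=> s1 rho m [_ [c1 [i1 [f1 [g1 [y1 [r1 [n1 ->]]]]]]]].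
  - move=> s1 rho m lt_s1 [em [c1 [i1 [f1 [g1 [y1 [r1 [n1 ->]]]]]]]].
    eapply wp_time.
      eapply (@wp_for K l w l_gt0 lw H (J s1)
        (fun i => \sum_(0 <= v < V) (13 * mu s1 i v + 210) + 6)) => //=.
      + by rewrite /J cats0; split=> //; exists c1, f1, g1, y1, r1, n1.
      + by move=> i2 rho2 m2 [_ [c2 [f2 [g2 [y2 [r2 [n2 ->]]]]]]].
      + move=> i2 rho2 m2 lt_i2 [em2 [c2 [f2 [g2 [y2 [r2 [n2 ->]]]]]]].
        eapply wp_time.
          eapply (@wp_for K l w l_gt0 lw V (L s1 i2)
            (fun v => 200 + (13 * mu s1 i2 v + 2))) => //=.
          * by lia.
          * by rewrite /L /partial_output /= !cats0; split=> //; exists f2, g2, y2, r2, n2.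
          * by move=> v3 rho3 m3 [_ [f3 [g3 [y3 [r3 [n3 ->]]]]]].
          * move=> v3 rho3 m3 lt_v3 [em3 [f3 [g3 [y3 [r3 [n3 ->]]]]]].
            apply: wp_seq; apply: wp_mult => //.
              move=> d lt_d; rewrite (proj1 em3); last exact: table_cell_lt.
              exact: tab.
            move=> f4 g4 y4 r4; rewrite -/(mu s1 i2 v3).
            eapply wp_time.
              eapply (@wp_loop K l w l_gt0 lw (mu s1 i2 v3) (fun e rho m' =>
                emitted m0 (partial_output s1 i2 v3 e) m' /\
                rho = env [:: base + 1 + size (partial_output s1 i2 v3 e),
                  v3, i2, j, x, s1, f4, g4, y4, r4, mu s1 i2 v3 - e & rest])
                (fun _ => 11)) => //=.
              - by rewrite subn0.
              - move=> e rho4 m4 lt_e [em4 ->] /=; split; first by lia.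
                have sz := size_partial_output lt_s1 lt_i2 lt_v3 lt_e.
                have sz' := size_partial_output lt_s1 lt_i2 lt_v3 (ltnW lt_e).
                have outS : partial_output s1 i2 v3 e.+1 =
                    rcons (partial_output s1 i2 v3 e) v3.
                  by rewrite /partial_output -addn1 nseqD -cats1 !catA.
                rewrite outS size_rcons in sz.
                apply: wp_bounds => lt_m4 lt_rho4.
                eapply wp_time.
                  eapply wp_seq; apply: wp_store => //=; first exact: (lt_rho4 11).
                  eapply wp_seq; apply: wp_assign => //=; first by lia.
                  apply: wp_assign => //=; first exact: leq_ltn_trans (leq_subr _ _) (lt_rho4 20).
                  split; last first.
                    rewrite outS size_rcons -[mu _ _ _ - e - 1]subnDA [e + 1]addn1.
                    by rewrite -[(size _).+1]addn1 !addnA.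
                  by rewrite outS; apply: emitted_rcons.
                by [].
              - move=> rho4 m4 [em4 ->] /=; rewrite subnn; split=> //; split=> //.
                have outS : partial_output s1 i2 v3 (mu s1 i2 v3) =
                    partial_output s1 i2 v3.+1 0.
                  by rewrite /partial_output blockS /= cats0.
                rewrite outS in em4 *; split=> //; by exists f4, g4, y4, r4, 0.
            by rewrite /= sum_nat_const_nat subn0; lia.
          * move=> rho3 m3 [em3 [f3 [g3 [y3 [r3 [n3 ->]]]]]]; split=> //.
            have outS : partial_output s1 i2 V 0 = sides s1 ++
               block_word i2.+1 V (fun i v => mult k M (row_table M F s1) i (flip s1 v)).
              by rewrite /partial_output block_wordS /= cats0.
            rewrite outS in em3 *; split=> //; by exists V, f3, g3, y3, r3, n3.
        rewrite /= (_ : \sum_(0 <= i0 < V) _ =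
          \sum_(0 <= v < V) (13 * mu s1 i2 v + 210)); first by lia.
        by apply: eq_bigr => v _; lia.
      + move=> rho2 m2 [em2 [c2 [f2 [g2 [y2 [r2 [n2 ->]]]]]]]; split=> //.
        have outS : sides s1 ++ block_word H V
            (fun i v => mult k M (row_table M F s1) i (flip s1 v)) = sides s1.+1.
          by rewrite /sides flatten_iotaS.
        rewrite outS in em2 *; split=> //; by exists c2, H, f2, g2, y2, r2, n2.
    have sz := size_side_le lt_s1; rewrite /side /lcwis_side size_block_word in sz.
    rewrite /= !big_split /= !sum_nat_const_nat !subn0.
    rewrite (_ : \sum_(0 <= i0 < H) \sum_(0 <= v < V) (13 * mu s1 i0 v + 210) =
      13 * (\sum_(0 <= i0 < H) \sum_(0 <= v < V) mu s1 i0 v) + H * (V * 210)).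
      move: sz; rewrite -/H -[4 * k + 2 * M]/V -/(mu s1 _ _) -mulnA.
      by move: (\sum_(_ <= _ < _) _) (H * (V * 210)) (M.+1 ^ 2 * H) => *; lia.
    rewrite big_distrr /= -[H in H * (V * 210)]subn0 -sum_nat_const_nat -big_split /=.
    apply: eq_bigr => i0 _; rewrite big_split /= sum_nat_const_nat subn0.
    by rewrite big_distrr.
  - move=> rho m [em [c1 [i1 [f1 [g1 [y1 [r1 [n1 ->]]]]]]]].
    have szE : size (sides 2) = 2 * size (side 0).
      rewrite /sides /= cats0 size_cat /side (@size_lcwis_side 1 0 _ _ _ (row_table M F 0)) //.
      by rewrite mul2n addnn.
    have sz := size_sides_le.
    apply: wp_store => //=; rewrite -/base; first by lia.
    have -> : (base + 1 + size (sides 2) - base - 1) %/ 2 = size (side 0) by lia.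
    split; last by eexists.
    move=> z; case: z => [|z]; first by rewrite addn0 upd_same.
    rewrite upd_other; last by lia.
    by have := proj2 em z; rewrite -addnA add1n => -> /=; rewrite /sides /= cats0.
rewrite /= sum_nat_const_nat subn0.
have : H * V <= 6 * (M.+1 ^ 2 * H).
  rewrite mulnC mulnA leq_mul2r; apply/orP; right; lia.
have : H <= M.+1 ^ 2 * H by rewrite leq_pmull // expn_gt0.
rewrite [H * (V * 210)]mulnA; move: (H * V) (M.+1 ^ 2 * H) (H); lia.
Qed.

End Emit.

(** * Assembling the program *)

Definition build_prog K : cmd :=
  Seq (init_prog K) (Seq (parse_prog K) (Seq (table_prog K) (Seq (emit_prog K)
    (assign K 10 (Cst 12 * (Var 1 * (Var 5 - Cst 1)))%expr)))).

(** [K] exceeds every register of [p], so [p] finds its registers at 0, as in an initial state.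
    Variable 7 is the address of the instance and variable 10 the constant part of the LCWIS length,
    subtracted before halving. *)
Definition reduction_prog (p : cmd) : cmd :=
  let K := (max_reg p).+1 in
  Seq (build_prog K) (Seq (relocate (K + 7) (K + nvars) p)
    (Seq (Op OpSub 0 0 (K + 10)) (Seq (Const (K + 11) 2) (Op OpDiv 0 0 (K + 11))))).

Lemma encode_cnf_lt N M (F : cnf N) l a : size F = M -> wf_cnf F -> N < l ->
  M < 2 ^ l -> nth 0 (encode_cnf F) a < word_bound l.
Proof.
move=> size_F wf_F lt_Nl lt_Ml.
have ltN : 2 * N < word_bound l.
  apply: (@leq_ltn_trans (2 * 2 ^ l)).
    by rewrite leq_mul2l /= ltnW // (ltn_trans lt_Nl) // ltn_expl.
  by rewrite /word_bound -expnS ltn_exp2l //; lia.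
have ltM : M < word_bound l.
  by apply: leq_trans lt_Ml _; rewrite leq_exp2l //; lia.
case: a => [|[|a]] /=; [by lia | by rewrite size_F|].
have [lt_a|ge_a] := ltnP a (size (flatten (map (@encode_clause N) F))); last first.
  by rewrite nth_default // expn_gt0.
have /flattenP[s /mapP[c Fc ->]] := mem_nth 0 lt_a.
have [i lt_i <-] : exists2 i, i < size F & nth [::] F i = c.
  by exists (index c F); rewrite ?index_mem // nth_index.
rewrite inE => /orP[/eqP->|/mapP[[x b] _ ->]].
  exact: leq_ltn_trans (size_clause_le wf_F i) ltN.
by rewrite /encode_literal /=; have := ltn_ord x; case: b; lia.
Qed.

Section Build.
Variables (K l w N M : nat) (F : cnf N).
Hypotheses (size_F : size F = M) (wf_F : wf_cnf F).
Hypotheses (lw : l * 64 <= w) (lt_Nl : N < l) (lt_Ml : M < 2 ^ l).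
Let l_gt0 : 0 < l. Proof. lia. Qed.

Lemma le_vars_pow : N <= 2 * 2 ^ half_vars N.
Proof. by have := ltn_expl (half_vars N) (ltnSn 1); rewrite {1}/half_vars; lia. Qed.

Lemma rows_le_pow : 2 ^ log_rows N M <= 2 ^ half_vars N.
Proof. by rewrite leq_exp2l // log_rows_le. Qed.

Lemma wp_build : wp K l w (build_prog K) (nseq nvars 0) (nth 0 (encode_cnf F))
  (100 * (100 * (M.+1 ^ 2 * 2 ^ half_vars N)))
  (fun rho m => [/\ has_instance M F m, nth 0 rho 7 = instance_base N M
     & nth 0 rho 10 = 12 * M * (2 ^ log_rows N M - 1)]).
Proof.
have bnd := instance_fits lt_Nl lt_Ml; have leNh := le_vars_pow; have leHP := rows_le_pow.
have lehN := half_vars_le N.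
have ltN : N < word_bound l := encode_cnf_lt 0 size_F wf_F lt_Nl lt_Ml.
have ltM : M < word_bound l by rewrite -size_F; exact: (encode_cnf_lt 1 size_F wf_F lt_Nl lt_Ml).
have le_base : mask_base N M <= table_base N M <= instance_base N M.
  by rewrite /instance_base /table_base; lia.
have k_le := log_rows_le N M.
have kM_le : log_rows N M <= M by apply: geq_minr.
have big6 := @weight_le N M _ (leqnn _).
eapply wp_time.
  eapply wp_seq; rewrite /init_prog.
  eapply wp_seq; apply: wp_assign => //=.
  eapply wp_seq; apply: wp_assign => //=; rewrite size_F //.
  eapply wp_seq; apply: wp_assign => //=; rewrite -/(half_vars N); first by lia.
  eapply wp_seq; apply: wp_assign => //=; rewrite -/(mask_base N M); first by lia.
  (* The program obtains the minimum by truncated subtraction. *)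
  have kE : half_vars N - (half_vars N - M) = log_rows N M by rewrite /log_rows; lia.
  eapply wp_seq; apply: wp_assign => //=; rewrite kE; first by lia.
  eapply wp_seq; apply: wp_assign => //=; rewrite ?shiftlE ?mul1n;
    [by do !split=> //; lia | by lia |].
  eapply wp_seq; apply: wp_assign => //=; rewrite -/(table_base N M); first by lia.
  eapply wp_seq; apply: wp_assign => //=; rewrite -/(instance_base N M); first by lia.
  eapply wp_seq; apply: wp_assign => //=; rewrite ?shiftlE ?mul1n;
    [by do !split=> //; lia | by lia |].
  apply: wp_assign => //=; rewrite -/(alphabet N M).
    by rewrite /alphabet; lia.
  eapply wp_seq; apply: wp_weaken; first exact: (wp_parse size_F wf_F lw lt_Nl lt_Ml).
    exact: leqnn.
  move=> rho m [masks [p1 [c1 [i1 [j1 [x1 ->]]]]]].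
  eapply wp_seq; apply: wp_weaken; first exact: (wp_table lw lt_Nl lt_Ml masks).
    exact: leqnn.
  move=> rho2 m2 [tabs [c2 [i2 [s2 [f2 ->]]]]].
  eapply wp_seq; apply: wp_weaken; first exact: (wp_emit lt_Nl lt_Ml lw tabs).
    exact: leqnn.
  move=> rho3 m3 [inst [rest ->]].
  apply: wp_assign => //=.
    have := leq_pmulr (6 * M) (_ : 0 < 2 ^ log_rows N M); rewrite expn_gt0 => /(_ isT).
    rewrite mulnBr muln1 => ?; lia.
  by rewrite nth_set_nth /= mulnA.
rewrite /=; have P_gt0 : 0 < 2 ^ half_vars N by rewrite expn_gt0.
set P := 2 ^ half_vars N in leNh leHP P_gt0 *.
have h1 : M.+1 ^ 2 * 2 ^ log_rows N M <= M.+1 ^ 2 * P by rewrite leq_mul2l leHP orbT.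
have h2 : M * (100 * N + 40) <= 240 * (M.+1 ^ 2 * P).
  apply: (@leq_trans (M * (240 * P))); first by rewrite leq_mul2l; lia.
  by rewrite mulnCA leq_mul2l leq_mul2r; apply/orP; right; apply/orP; right; lia.
have h3 : P * (M * 1000 + 1000) <= 1000 * (M.+1 ^ 2 * P).
  rewrite [1000 * _]mulnA [X in X <= _]mulnC leq_mul2r; apply/orP; right; lia.
have h4 : 1 <= M.+1 ^ 2 * P by rewrite muln_gt0 expn_gt0.
move: h1 h2 h3 h4; move: (M.+1 ^ 2 * P) (M.+1 ^ 2 * _) (M * _) (P * _); lia.
Qed.

End Build.

Lemma is_LCWIS_length_unique (A B : seq nat) k k' :
  is_LCWIS_length A B k -> is_LCWIS_length A B k' -> k = k'.
Proof.
case=> -[C cC <-] maxC [[D cD <-] maxD]; apply/eqP.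
by rewrite eqn_leq maxD ?maxC.
Qed.

(** Relocation doubles the time of [p]; passing from 100 to 101 absorbs the three final
    instructions. *)
Lemma reduction_correct (p : cmd) (c N M : nat) (F : cnf N) t0 k0 :
  size F = M -> wf_cnf F ->
  let A := side M F 0 in let B := side M F 1 in
  outputs (LCWIS_word c (size A) A B) p (encode_LCWIS A B) t0 k0 ->
  is_LCWIS_length A B k0 ->
  exists2 t, outputs (max_sat_word (16 * c + 64) N M) (reduction_prog p)
    (encode_cnf F) t (max_sat F) &
    t <= 2 * t0 + 101 * (100 * (M.+1 ^ 2 * 2 ^ half_vars N)).
Proof.
move=> size_F wf_F A B [s0 E0 out0] lcwis0.
set l := (N + trunc_log 2 M).+1.
have lt_Nl : N < l by rewrite ltnS leq_addr.
have lt_Ml : M < 2 ^ l.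
  apply: leq_trans (trunc_log_ltn M (ltnSn 1)) _.
  by rewrite leq_exp2l // ltnS leq_addl.
set w := max_sat_word _ _ _.
have wE : w = 16 * c * l + 64 * l by rewrite /w /max_sat_word -/l mulnDl.
have lw : l * 64 <= w by rewrite wE mulnC leq_addl.
have bnd := side_fits lt_Nl lt_Ml.
set w0 := LCWIS_word _ _ _ _ in E0.
(* The length of [A] plus the largest symbol is below [2 ^ (16 * l)], which bounds the word length
   of [p] by [16 * c * l]. *)
have le_w0 : w0 <= 16 * c * l.
  rewrite /w0 /LCWIS_word -mulnA mulnCA leq_mul2l; apply/orP; right.
  set X := _ + _; have ltX : X < 2 ^ (16 * l).
    rewrite mulnC; apply: leq_ltn_trans bnd.
    have szA : size A <= 36 * M.+1 ^ 2 * 2 ^ log_rows N M by apply: size_side_le.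
    have max_le : \max_(x <- A ++ B) x <= 6 * M.
      apply/bigmax_leqP_seq => x; rewrite mem_cat => x_in _.
      apply: leq_trans (alphabet_le N M); apply: ltnW.
      by case/orP: x_in => /mem_block_word.
    have := weight_le (leqnn (log_rows N M)); rewrite /X.
    have -> : 72 * M.+1 ^ 2 * 2 ^ log_rows N M =
       36 * M.+1 ^ 2 * 2 ^ log_rows N M + 36 * M.+1 ^ 2 * 2 ^ log_rows N M.
      by rewrite -mulnDl; congr (_ * _); lia.
    have : M <= M.+1 ^ 2 * 2 ^ log_rows N M.
      by apply: (@leq_trans (M.+1 ^ 2 * 1)); rewrite ?leq_mul2l ?expn_gt0 ?orbT //; lia.
    rewrite -[36 * M.+1 ^ 2 * _]mulnA in szA *; lia.
  have [X0|X_gt0] := posnP X; first by rewrite X0 trunc_log0 muln_gt0.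
  rewrite -(ltn_exp2l _ _ (ltnSn 1)); apply: leq_ltn_trans ltX.
  exact: trunc_logP.
pose K := (max_reg p).+1; set base := instance_base N M in bnd.
have base_lt : base < 2 ^ (16 * l) by rewrite mulnC; apply: leq_ltn_trans bnd; lia.
(* The other [64 * l] bits of [w] cover the base address and one carry. *)
have room : 2 ^ w0 + base <= 2 ^ w.
  apply: (@leq_trans (2 ^ (16 * c * l + 16 * l) + 2 ^ (16 * c * l + 16 * l))).
    apply: leq_add; first by rewrite leq_exp2l // (leq_trans le_w0) // leq_addr.
    by apply: ltnW; apply: leq_trans base_lt _; rewrite leq_exp2l // leq_addl.
  by rewrite addnn -mul2n -expnS leq_exp2l // wE; lia.
have repr0 : represents K l (init_state (encode_cnf F)) (nseq nvars 0) (nth 0 (encode_cnf F)).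
  split=> // [x lt_x|x|a]; first by rewrite nth_nseq lt_x.
    by rewrite nth_nseq if_same expn_gt0.
  exact: encode_cnf_lt lt_Ml.
have [t1 [s1 [rho1 [m1 [E1 le1 [R1 M1 Z1 _ _] [inst rho7 rho10]]]]]] :=
  wp_build size_F wf_F lw lt_Nl lt_Ml repr0.
have reloc1 : relocated w0 K base (K + 7) (init_state (encode_LCWIS A B)) s1.
  split=> [r lt_r|a||r] /=.
  - exact: Z1.
  - by rewrite M1 inst.
  - by rewrite R1 // rho7.
  - by rewrite expn_gt0.
have rb_rt : K + 7 != K + nvars by rewrite eqn_add2l.
have [t2 [s2 [E2 le2 [R2 _ _ W2] F2]]] := exec_relocate (rt := K + nvars) room
  (leq_addr _ _) (leq_addr _ _) rb_rt E0 (ltnSn _) reloc1.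
have k0E : k0 = 12 * M * (2 ^ log_rows N M - 1) + 2 * max_sat F.
  exact: is_LCWIS_length_unique lcwis0 (lcwis_sides_length size_F).
have s2_0 : regs s2 0 = k0 by rewrite R2.
have s2_10 : regs s2 (K + 10) = 12 * M * (2 ^ log_rows N M - 1).
  by rewrite F2 ?leq_addr ?eqn_add2l // R1.
pose s3 := set_reg s2 0 (regs s2 0 - regs s2 (K + 10)).
pose s4 := set_reg s3 (K + 11) 2.
have s4_0 : regs s4 0 = 2 * max_sat F.
  by rewrite /= upd_other // upd_same s2_0 s2_10 k0E addKn.
have k0_lt : k0 < 2 ^ w.
  by rewrite -out0; apply: leq_trans (W2 0) _; lia.
pose s5 := set_reg s4 0 (regs s4 0 %/ regs s4 (K + 11)).
exists (t1 + (t2 + (1 + (1 + 1)))); last first.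
  have : 1 <= M.+1 ^ 2 * 2 ^ half_vars N by rewrite muln_gt0 !expn_gt0.
  by lia.
exists s5; last first.
  transitivity (regs s4 0 %/ regs s4 (K + 11)); first by rewrite /= upd_same.
  by rewrite s4_0 [regs s4 _]upd_same mulKn.
apply: ExecSeq E1 _; apply: ExecSeq E2 _.
apply: (ExecSeq (s1 := s3)).
  by apply: ExecOp; rewrite /= s2_0; apply: leq_ltn_trans k0_lt; apply: leq_subr.
apply: (ExecSeq (s1 := s4)).
  by apply: ExecConst; rewrite -{1}[2]expn1 ltn_exp2l //; rewrite wE; lia.
apply: ExecOp; rewrite [eval_binop _ _ _]/(regs s4 0 %/ regs s4 (K + 11)).
rewrite s4_0 (leq_ltn_trans (leq_div _ _)) //; apply: leq_ltn_trans k0_lt.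
by rewrite k0E leq_addl.
Qed.

(** * Sublinear time is impossible *)

Lemma bigmax_const1 (s : seq nat) : 1 \in s -> all (leq^~ 1) s -> \max_(x <- s) x = 1.
Proof.
move=> s1 /allP le1; apply/eqP; rewrite eqn_leq; apply/andP; split.
  by apply/bigmax_leqP_seq => x /le1.
exact: (bigop.leq_bigmax_seq (F := id) _ s1).
Qed.

(* If a cell of [A = 1^n] is not read, changing it to 0 goes unnoticed although
   the answer drops below [n]. *)
Lemma LCWIS_time_linear (R : realType) (T : nat -> R) : LCWIS_algorithm T ->
  forall n, 2 <= n -> (n%:R <= T n)%R.
Proof.
case=> p [c alg] n n_ge2.
pose A := nseq n 1.
have szA : size A = n by rewrite size_nseq.
have [t [k [[s E out] len le_tT]]] := alg n A A szA szA.
apply: le_trans le_tT; rewrite ler_nat leqNgt; apply/negP => lt_tn.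
have sortA : sorted <=%O A by rewrite /A; elim: (n) => // -[|m] //= ->.
have kE : k = n.
  have [[C [_ subA _] <-] max_k] := len.
  apply/eqP; rewrite eqn_leq -{1}szA size_subseq //=.
  by have := max_k A; rewrite szA; apply; split.
have [S szS local] := exec_local E.
(* Cells 1 to [n] hold the first sequence, and fewer than [n] cells are read. *)
have [i lt_i notS] : exists2 i, i < n & i.+1 \notin S.
  apply: contrapT => none; suff : n <= size S by lia.
  rewrite -(size_iota 1 n); apply: uniq_leq_size; first exact: iota_uniq.
  move=> x; rewrite mem_iota add1n ltnS => /andP[x_gt0 le_x].
  apply: contrapT => /negP nSx; apply: none; exists x.-1; first by lia.
  by rewrite prednK.
pose A' := set_nth 0 A i 0.
have szA' : size A' = n by rewrite size_set_nth szA; lia.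
have ltA x : x < n -> nth 0 A x = 1 by move=> lt_x; rewrite nth_nseq lt_x.
have [|m' E' _] := local (nth 0 (encode_LCWIS A' A)).
  move=> [|a] Sa //=; first by rewrite szA szA'.
  rewrite !nth_cat szA szA'; case: ifP => // lt_a.
  rewrite nth_set_nth /=; case: eqP => // eq_a.
  by rewrite eq_a in Sa; rewrite Sa in notS.
have [t2 [k2 [[s2 E2 out2] [[C [_ subA' subA] szC] _] _]]] := alg n A' A szA' szA.
(* The second sequence still contains a 1, so the largest symbol and with it the word length are
   unchanged. *)
have w_eq : LCWIS_word c n A' A = LCWIS_word c n A A.
  have A1 : 1 \in A by rewrite mem_nseq eqxx andbT; lia.
  have allA : all (leq^~ 1) A by rewrite all_nseq orbT.
  have allA' : all (leq^~ 1) A'.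
    apply/(all_nthP 0) => x; rewrite szA' nth_set_nth /= => lt_x.
    by case: eqP => // _; rewrite ltA.
  by rewrite /LCWIS_word !bigmax_const1 ?all_cat ?mem_cat ?A1 ?allA ?allA' ?orbT.
rewrite w_eq in E2.
have := exec_deterministic E2 E' => s2E.
have k2E : k2 = n by rewrite -out2 s2E /= out.
(* A common subsequence of full length [n] equals both sequences, but they differ at [i]. *)
have eqC : C = A' by apply/eqP; rewrite -(size_subseq_leqif subA') szC szA' k2E.
have eqC' : C = A by apply/eqP; rewrite -(size_subseq_leqif subA) szC szA k2E.
have : nth 0 A' i = nth 0 A i by rewrite -eqC -eqC'.
by rewrite nth_set_nth /= eqxx ltA.
Qed.

(** * Growth of the time bounds, and the theorem *)

Local Open Scope classical_set_scope.
Local Open Scope ring_scope.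

Section Growth.
Variables (R : realType) (eps : R) (T : nat -> R).
Hypothesis T_O : T =O_\oo (fun n : nat => n%:R `^ (2 - eps)).

Lemma bigO_bound : exists2 C : R, 0 < C &
  exists n0, forall n, (n0 <= n)%N -> T n <= C * n%:R `^ (2 - eps).
Proof.
move: T_O => /eqO_exP[C C_gt0 [n0 _ Hn0]]; exists C => //; exists n0 => n le_n.
apply: le_trans (ler_norm _) _; apply: le_trans (Hn0 n le_n) _.
by rewrite ger0_norm // powR_ge0.
Qed.

(** For [n] above the power [(eps - 1)^-1] of [C], the constant [C] is below the power [eps - 1] of
    [n], which brings the bound on [T n] below [n]. *)
Lemma bigO_sublinear : 1 < eps -> exists2 n, (2 <= n)%N & T n < n%:R.
Proof.
move=> eps_gt1; have [C C_gt0 [n0 Hn0]] := bigO_bound.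
have e_gt0 : 0 < eps - 1 by rewrite subr_gt0.
pose n := maxn n0 (maxn 2 (Num.truncn (C `^ (eps - 1)^-1)).+1).
exists n; first by rewrite !leq_max leqnn orbT.
have lt_n : C `^ (eps - 1)^-1 < n%:R.
  apply: lt_le_trans (truncnS_gt _) _.
  by rewrite ler_nat !leq_max leqnn !orbT.
have n_gt0 : 0 < n%:R :> R by apply: le_lt_trans lt_n; apply: powR_ge0.
apply: le_lt_trans (Hn0 n _) _; first by rewrite leq_maxl.
have lt_C : C < n%:R `^ (eps - 1).
  have -> : C = (C `^ (eps - 1)^-1) `^ (eps - 1).
    by rewrite -powRrM mulVf ?powRr1 ?ltW //; apply: lt0r_neq0.
  by apply: gt0_ltr_powR => //; rewrite nnegrE ?powR_ge0 // ltW.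
have powE : n%:R `^ (eps - 1) * n%:R `^ (2 - eps) = n%:R :> R.
  rewrite -powRD; last by rewrite (gt_eqF n_gt0) implybT.
  by rewrite (_ : eps - 1 + (2 - eps) = 1) ?powRr1 ?ltW //; ring.
rewrite -[X in _ < X]powE ltr_pM2r //; exact: powR_gt0.
Qed.

(** With base [n.+1] the power is at least 1, so the finitely many values of [T] before [n0] can be
    absorbed in the constant. *)
Lemma bigO_uniform : eps <= 1 -> exists2 C : R, 0 < C &
  forall n, T n <= C * n.+1%:R `^ (2 - eps).
Proof.
move=> eps_le1; have [C C_gt0 [n0 Hn0]] := bigO_bound.
exists (C + \sum_(i < n0) `|T i|); first by rewrite ltr_pwDl // sumr_ge0.
move=> n; rewrite mulrDl.
have pow_ge1 : 1 <= n.+1%:R `^ (2 - eps) :> R.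
  by rewrite -[1 in X in X <= _](powRr0 n.+1%:R) ler_powR ?ler1n //; lra.
have [le_n|lt_n] := leqP n0 n.
  apply: le_trans (Hn0 n le_n) _; rewrite -[X in X <= _]addr0 lerD //.
    rewrite ler_pM2l //; apply: ge0_ler_powR; rewrite ?nnegrE ?ler_nat //; lra.
  by rewrite mulr_ge0 ?powR_ge0 ?sumr_ge0.
apply: le_trans (ler_norm _) _; rewrite -[X in X <= _]add0r lerD //.
  by rewrite mulr_ge0 ?powR_ge0 // ltW.
apply: (@le_trans _ _ (\sum_(i < n0) `|T i|)); last by rewrite ler_peMr // sumr_ge0.
by rewrite (bigD1 (Ordinal lt_n)) //= lerDl sumr_ge0.
Qed.

End Growth.

Lemma pow_half_vars_le (R : realType) N :
  (2 ^ half_vars N)%N%:R <= 2 * 2 `^ (N%:R / 2) :> R.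
Proof.
rewrite natrX -powR_mulrn // -[X in X * _]powRr1 // -powRD; last by rewrite pnatr_eq0 implybT.
apply: ler_powR; first by rewrite ler1n.
have : (2 * half_vars N <= N + 1)%N by rewrite /half_vars; lia.
by rewrite -(ler_nat R) natrM natrD; lra.
Qed.

Theorem theorem1 (R : realType) (eps : R) (eps_gt0 : 0 < eps) :
  (exists2 T : nat -> R,
      T =O_\oo (fun n : nat => n%:R `^ (2 - eps)) & LCWIS_algorithm T) ->
  exists p : {poly R},
    MAX_CNF_SAT_algorithm
      (fun N M : nat => 2 `^ ((1 - eps / 2) * N%:R) * p.[M%:R]).
Proof.
case=> T T_O alg.
have [eps_gt1|eps_le1] := ltP 1 eps.
  have [n n_ge2] := bigO_sublinear T_O eps_gt1.
  by rewrite ltNge (LCWIS_time_linear alg).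
have [C C_gt0 T_le] := bigO_uniform T_O eps_le1.
case: alg => p [c alg].
(* The first term pays for the relocated LCWIS run, the second for building the instance; in
   [202 = 2 * 101] the factor 2 is lost by rounding [N / 2] up. *)
exists ((2 * C * 74 ^+ 2) *: ('X + 1%:P) ^+ 4 + (202 * 100) *: ('X + 1%:P) ^+ 2).
exists (reduction_prog p), (16 * c + 64)%N => N M F wf_F size_F.
set A := side M F 0; set B := side M F 1.
have szB : size B = size A by apply: size_lcwis_side.
have [t0 [k0 [out0 len0 le_t0]]] := alg (size A) A B erefl szB.
have [t out le_t] := reduction_correct size_F wf_F out0 len0.
exists t; split=> //.
rewrite hornerD !hornerZ !horner_exp !hornerD hornerX hornerC.
apply: (@le_trans _ _
  (2 * t0 + 101 * (100 * (M.+1 ^ 2 * 2 ^ half_vars N)))%N%:R); first by rewrite ler_nat.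
set m : R := M%:R + 1; have mE : m = M.+1%:R by rewrite -natr1.
have m_ge1 : 1 <= m by rewrite mE ler1n.
set Y := 2 `^ ((1 - eps / 2) * N%:R).
set Z : R := 2 `^ (N%:R / 2).
(* As [eps <= 1], the time for building the instance stays within the target. *)
have le_ZY : Z <= Y.
  apply: ler_powR; first by rewrite ler1n.
  have : 0 <= N%:R * (1 - eps) :> R by rewrite mulr_ge0 //; lra.
  by lra.
have Z_ge1 : 1 <= Z.
  by rewrite -[X in X <= _](powRr0 2) ler_powR ?ler1n // divr_ge0.
have le_hZ := pow_half_vars_le R N.
have m2E : (M.+1 ^ 2)%N%:R = m ^+ 2 by rewrite natrX -mE.
(* Here [74 = 2 * 37]: replacing 36 by 37 absorbs the successor, and the 2 comes from
   [pow_half_vars_le]. *)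
have le_nA : (size A).+1%:R <= 74 * m ^+ 2 * Z.
  have leA : (size A <= 36 * M.+1 ^ 2 * 2 ^ half_vars N)%N.
    apply: (@leq_trans (36 * M.+1 ^ 2 * 2 ^ log_rows N M)); first exact: size_side_le.
    by rewrite leq_mul2l leq_exp2l // log_rows_le orbT.
  have {}leA : (size A < 37 * M.+1 ^ 2 * 2 ^ half_vars N)%N.
    apply: leq_ltn_trans leA _; rewrite ltn_mul2r expn_gt0 /=.
    by rewrite ltn_mul2r expn_gt0.
  apply: (@le_trans _ _ (37 * M.+1 ^ 2 * 2 ^ half_vars N)%N%:R); first by rewrite ler_nat.
  rewrite natrM natrM m2E.
  have -> : 74 * m ^+ 2 * Z = 37 * m ^+ 2 * (2 * Z) by ring.
  by apply: ler_wpM2l => //; rewrite mulr_ge0 ?exprn_ge0 //; lra.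
have le_T : t0%:R <= C * (74 ^+ 2 * m ^+ 4 * Y).
  apply: le_trans le_t0 _; apply: le_trans (T_le _) _; rewrite ler_pM2l //.
  have K_ge1 : 1 <= 74 * m ^+ 2 by rewrite mulr_ege1 ?exprn_ege1 // ler1n.
  apply: (@le_trans _ _ ((74 * m ^+ 2 * Z) `^ (2 - eps))).
    apply: ge0_ler_powR; rewrite ?nnegrE //; first lra.
    by rewrite mulr_ge0 //; lra.
  rewrite powRM; [|lra|lra].
  (* The exponents meet here: [N / 2] times [2 - eps] is [(1 - eps / 2) * N]. *)
  have -> : Z `^ (2 - eps) = Y.
    by rewrite /Z -powRrM /Y; congr (_ `^ _); field.
  apply: ler_wpM2r; first exact: powR_ge0.
  (* The polynomial factor is at least 1, so its exponent [2 - eps] may be raised to 2. *)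
  have -> : 74 ^+ 2 * m ^+ 4 = (74 * m ^+ 2) `^ 2%:R by rewrite powR_mulrn; [ring | lra].
  by apply: ler_powR => //; lra.
rewrite natrD (natrM _ 2) (natrM _ 101) (natrM _ 100) natrM m2E.
have -> : Y * (2 * C * 74 ^+ 2 * m ^+ 4 + 202 * 100 * m ^+ 2) =
    2 * (C * (74 ^+ 2 * m ^+ 4 * Y)) + 101 * (100 * (m ^+ 2 * (2 * Y))) by ring.
apply: lerD; first by apply: ler_wpM2l.
do 2![apply: ler_wpM2l => //]; apply: ler_wpM2l; first by rewrite exprn_ge0 //; lra.
by apply: le_trans le_hZ _; rewrite ler_pM2l.
Qed.
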